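(* Let $p$ be an odd prime, let $n\ge 4$ be an even integer, and let $f:\mathbb{F}_p^n\to\mathbb{F}_p$ be a non-weakly regular bent function belonging to $\mathcal{DBF}$ such that $B_-(f)$ and $B_-(f^* )$ are both non-degenerate $r$-dimensional subspaces of $\mathbb{F}_p^n$ over $\mathbb{F}_p$. (i) If $r=\frac n2+1$, then $$U_2=\{\{0\},\ c_0(f),c_1(f),\dots,c_{p-1}(f),\ d_0(f)\setminus\{0\},\ d_1(f),\dots,d_{p-1}(f)\}$$ is a partition of $\mathbb{F}_p^n$ and induces a $2p$-class symmetric association scheme. (ii) If $\frac n2+1<r\le n-1$, then $$U_3=\{\{0\},\ c_0(f),c_1(f),\dots,c_{p-1}(f),\ B_-(f)^\bot\setminus\{0\},\ d_0(f)\setminus B_-(f)^\bot,\ d_1(f),\dots,d_{p-1}(f)\}$$ is a partition of $\mathbb{F}_p^n$ and induces a $(2p+1)$-class symmetric association scheme.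
   Context: Let $p$ be an odd prime, $n$ a positive integer, $x\cdot y$ the ordinary inner product on $\mathbb{F}_p^n$, and $\xi_p=e^{2\pi\sqrt{-1}/p}$. Bent functions. For $f:\mathbb{F}_p^n\to\mathbb{F}_p$ the Walsh transform is $\mathcal{W}_f(\alpha)=\sum_{x\in\mathbb{F}_p^n}\xi_p^{f(x)-\alpha\cdot x}$, $\alpha\in\mathbb{F}_p^n$; $f$ is bent if $|\mathcal{W}_f(\alpha)|=p^{n/2}$ for all $\alpha$. Put $\mu=1$ if $p^n\equiv1\pmod 4$ and $\mu=\sqrt{-1}$ if $p^n\equiv3\pmod4$. For a bent $f$ it is known that for every $\alpha$, $\mathcal{W}_f(\alpha)\in\{\mu p^{n/2}\xi_p^{f^*(\alpha)},-\mu p^{n/2}\xi_p^{f^*(\alpha)}\}$ for a (unique) function $f^*:\mathbb{F}_p^n\to\mathbb{F}_p$, called the dual of $f$. A bent $f$ is weakly regular if there is $\lambda\in\{\pm1,\pm\sqrt{-1}\}$ independent of $\alpha$ with $\mathcal{W}_f(\alpha)=\lambda p^{n/2}\xi_p^{f^*(\alpha)}$ for all $\alpha$; otherwise it is non-weakly regular. A bent $f$ is dual-bent if $f^*$ is also bent. For a bent function $f$: $B_+(f)=\{\alpha:\mathcal{W}_f(\alpha)=\mu p^{n/2}\xi_p^{f^*(\alpha)}\}$ and $B_-(f)=\{\alpha:\mathcal{W}_f(\alpha)=-\mu p^{n/2}\xi_p^{f^*(\alpha)}\}$. For $f$ dual-bent, $B_\pm(f^* )$ are defined by the same formulas applied to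 the bent function $f^*$. For dual-bent $f$ and $j\in\mathbb{F}_p$: $c_j(f)=\{x\in B_+(f^* ):f(x)=j\}$, $d_j(f)=\{x\in B_-(f^* ):f(x)=j\}$. $\mathcal{DBF}$ is the set of dual-bent functions $f:\mathbb{F}_p^n\to\mathbb{F}_p$ such that $f(0)=0$ and there is a positive integer $h$ with $\gcd(h-1,p-1)=1$ and $f(ax)=a^hf(x)$ for all $a\in\mathbb{F}_p^*$, $x\in\mathbb{F}_p^n$. For a subspace $V$ of $\mathbb{F}_p^n$, $V^\bot$ is its orthogonal complement with respect to $\cdot$; $V$ is non-degenerate if $\{x\in V:x\cdot y=0\ \text{for all } y\in V\}=\{0\}$. Association schemes. A $d$-class association scheme on a nonempty finite set $X$ is a partition of $X\times X$ into relations $R_0,\dots,R_d$ such that $R_0=\{(x,x):x\in X\}$; for each $j$ the transpose $R_j^T$ equals some $R_{j'}$; and for all $u,v,w$ and $(x,y)\in R_w$ the number $|\{z\in X:(x,z)\in R_u,(z,y)\in R_v\}|$ depends only on $u,v,w$. It is symmetric if $R_j^T=R_j$ for all $j$. A partition $\{U_i\}_{i=0}^d$ of $\mathbb{F}_p^n$ (into nonempty sets) with $U_0=\{0\}$ induces a $d$-class symmetric association scheme if the relations $R_i=\{(\alpha,\beta):\alpha-\beta\in U_i\}$, $0\le i\le d$, form a symmetric association scheme on $\mathbb{F}_p^n$. *)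

(* Defs.v *)
(* MathComp, with MathComp-Analysis for pi, cos, sin over a realType R, and
   R[i] from real-closed for the complex numbers. *)
From mathcomp Require Import all_boot all_order all_algebra.
From mathcomp Require Import reals trigo.
From mathcomp Require Import complex.
Set Implicit Arguments.
Unset Strict Implicit.
Unset Printing Implicit Defensive.
Import Order.TTheory GRing.Theory Num.Theory.
Local Open Scope ring_scope.
Local Open Scope complex_scope.

Definition dot (p n : nat) (x y : 'rV['F_p]_n) : 'F_p :=
  \sum_(i < n) x 0 i * y 0 i.

Definition orthc (p n : nat) (A : {set 'rV['F_p]_n}) : {set 'rV['F_p]_n} :=
  [set x | [forall y in A, dot x y == 0]].

Definition nondegenerate (p n : nat) (V : {vspace 'rV['F_p]_n}) : Prop :=
  forall x, x \in V -> (forall y, y \in V -> dot x y = 0) -> x = 0.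

Definition nondegenerate_subspace (p n r : nat) (A : {set 'rV['F_p]_n}) : Prop :=
  exists V : {vspace 'rV['F_p]_n},
    [/\ A = [set x | x \in V], \dim V = r & nondegenerate V].

Definition xi (R : realType) (p : nat) : R[i] :=
  cos (2 * pi / p%:R) +i* sin (2 * pi / p%:R).

(* The exponent in 'F_p is read as its representative in 0..p-1; this is
   harmless because xi R p ^+ p = 1. *)
Definition xi_pow (R : realType) (p : nat) (a : 'F_p) : R[i] :=
  xi R p ^+ (a : nat).

(* p ^ (n / 2), for n of either parity. *)
Definition root_pn (R : realType) (p n : nat) : R[i] :=
  (Num.sqrt (p%:R ^+ n : R))%:C.

Definition mu (R : realType) (p n : nat) : R[i] :=
  if (p ^ n == 1 %[mod 4])%N then 1 else 'i%C.

Section Bent.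
Variables (R : realType) (p n : nat).
Implicit Type f : 'rV['F_p]_n -> 'F_p.

Definition walsh f (a : 'rV['F_p]_n) : R[i] :=
  \sum_(x : 'rV['F_p]_n) xi_pow R (f x - dot a x).

Definition bent f : Prop := forall a, `|walsh f a| = root_pn R p n.

(* For bent f and p an odd prime, exactly one j satisfies the condition (a
   classical fact), and this is the value of the dual; the default value 0 is
   irrelevant then. *)
Definition dual f (a : 'rV['F_p]_n) : 'F_p :=
  odflt 0 [pick j : 'F_p |
    (walsh f a == mu R p n * root_pn R p n * xi_pow R j) ||
    (walsh f a == - (mu R p n * root_pn R p n * xi_pow R j))].

Definition weakly_regular f : Prop :=
  bent f /\
  exists lambda : R[i],
    lambda \in [:: 1; -1; 'i%C; - 'i%C] /\
    forall a, walsh f a = lambda * root_pn R p n * xi_pow R (dual f a).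

Definition non_weakly_regular f : Prop := bent f /\ ~ weakly_regular f.

Definition dual_bent f : Prop := bent f /\ bent (dual f).

Definition Bplus f : {set 'rV['F_p]_n} :=
  [set a | walsh f a == mu R p n * root_pn R p n * xi_pow R (dual f a)].

Definition Bminus f : {set 'rV['F_p]_n} :=
  [set a | walsh f a == - (mu R p n * root_pn R p n * xi_pow R (dual f a))].

Definition cset f (j : 'F_p) : {set 'rV['F_p]_n} :=
  [set x in Bplus (dual f) | f x == j].

Definition dset f (j : 'F_p) : {set 'rV['F_p]_n} :=
  [set x in Bminus (dual f) | f x == j].

Definition DBF f : Prop :=
  [/\ dual_bent f,
      f 0 = 0 &
      exists h : nat,
        [/\ (0 < h)%N,
            gcdn (h - 1) (p - 1) = 1%N &
            forall (a : 'F_p) (x : 'rV['F_p]_n),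
              a != 0 -> f (a *: x) = a ^+ h * f x]].

Definition U2 f : seq {set 'rV['F_p]_n} :=
  [set 0]
    :: [seq cset f j | j <- enum 'F_p]
    ++ (dset f 0 :\ 0)
    :: [seq dset f j | j <- enum 'F_p & j != 0].

Definition U3 f : seq {set 'rV['F_p]_n} :=
  [set 0]
    :: [seq cset f j | j <- enum 'F_p]
    ++ (orthc (Bminus f) :\ 0)
    :: (dset f 0 :\: orthc (Bminus f))
    :: [seq dset f j | j <- enum 'F_p & j != 0].

End Bent.

Definition transpose_rel (X : finType) (S : {set X * X}) : {set X * X} :=
  [set xy | (xy.2, xy.1) \in S].

Definition assoc_scheme (X : finType) (d : nat) (S : 'I_d.+1 -> {set X * X}) :
    Prop :=
  [/\ (0 < #|X|)%N,
      injective S /\ partition [set S i | i : 'I_d.+1] [set: X * X],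
      S ord0 = [set xy | xy.1 == xy.2],
      forall j, exists j', transpose_rel (S j) = S j' &
      exists c : 'I_d.+1 -> 'I_d.+1 -> 'I_d.+1 -> nat,
        forall u v w x y, (x, y) \in S w ->
          #|[set z | ((x, z) \in S u) && ((z, y) \in S v)]| = c u v w].

Definition symmetric_assoc_scheme (X : finType) (d : nat)
    (S : 'I_d.+1 -> {set X * X}) : Prop :=
  assoc_scheme S /\ forall j, transpose_rel (S j) = S j.

(* MathComp's partition already requires nonempty blocks; uniq makes the
   members of the list pairwise distinct, hence pairwise disjoint. *)
Definition is_partition (T : finType) (U : seq {set T}) : Prop :=
  uniq U /\ partition [set:: U] [set: T].

Definition induces_symmetric_scheme (p n d : nat) (U : seq {set 'rV['F_p]_n}) :
    Prop :=
  size U = d.+1 /\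
  symmetric_assoc_scheme
    (fun i : 'I_d.+1 => [set ab | ab.1 - ab.2 \in nth set0 U i]).

(* Main.v *)
(* Write P = p ^ (n / 2), L = B_-(f), g = f^*, M = B_-(g). Factoring |W_f|^2 =
   P^2 at the prime 1 - zeta of Z[zeta] shows that every Walsh value is a
   sign times P times a power of zeta. Inverting the transform and comparing
   coefficients modulo 2 gives f^** = f, and hence sum_(a in L) zeta^(g(a) -
   x.a) = - P [x in M] zeta^(f(x)), together with the same identity for (g,
   f). So L^orth is contained in M and f vanishes on it. Homogeneity of f
   gives homogeneity of g, so conjugating these sums by zeta -> zeta^t shows
   that the character sum at a of each block depends only on whether a = 0,
   a in L, a in M^orth, and on g(a), that is, on the block of a in the
   partition built from g. The two partitions being dual to each other in
   both directions, the number of ways to write w as a sum of elements of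
   two given blocks is constant on blocks. Block sizes are the character
   sums at 0; for r = n/2 + 1 they give d_0(f) = B_-(f)^orth. *)

Require Import Defs.
From mathcomp Require Import all_boot all_order all_algebra all_field.
From mathcomp Require Import ring zify.
From mathcomp Require Import reals trigo.
From mathcomp Require Import complex.
Set Implicit Arguments.
Unset Strict Implicit.
Unset Printing Implicit Defensive.
Import Order.TTheory GRing.Theory Num.Theory.
Local Open Scope ring_scope.

(** * The additive character of F_p *)

Section AdditiveCharacter.
Variables (C : numClosedFieldType) (p : nat) (z : C).
Hypotheses (p_prime : prime p) (z_prim : p.-primitive_root z).

(** For [z := xi R p] this is convertible to [xi_pow], so Walsh values over [R[i]] are sums of
    [addchar]. *)
Definition addchar (a : 'F_p) : C := z ^+ a.
Local Notation chi := addchar.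

Lemma val_FpD (a b : 'F_p) : (a + b : 'F_p) = ((a + b)%N %% p)%N :> nat.
Proof. exact: (congr1 (modn (a + b)) (Fp_cast p_prime)). Qed.

Lemma chi_nat k : chi k%:R = z ^+ k.
Proof. by rewrite /addchar val_Fp_nat // (prim_expr_mod z_prim). Qed.

Lemma chi0 : chi 0 = 1. Proof. by []. Qed.

Lemma chiD a b : chi (a + b) = chi a * chi b.
Proof. by rewrite /addchar val_FpD (prim_expr_mod z_prim) exprD. Qed.

Lemma chi_neq0 a : chi a != 0.
Proof.
by rewrite /addchar expf_neq0 // (prim_root_eq0 z_prim) -lt0n prime_gt0.
Qed.

Lemma chiN a : chi (- a) = (chi a)^-1.
Proof.
by apply: (mulIf (chi_neq0 a)); rewrite -chiD addNr chi0 mulVf ?chi_neq0.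
Qed.

Lemma norm_chi a : `|chi a| = 1.
Proof.
apply/eqP; rewrite -(@pexpr_eq1 _ _ p) ?prime_gt0 // -normrX -exprM mulnC exprM.
by rewrite (prim_expr_order z_prim) expr1n normr1.
Qed.

Lemma conj_chi a : (chi a)^* = chi (- a).
Proof. by rewrite chiN invC_norm norm_chi expr1n invr1 mul1r. Qed.

Lemma chi_eq1 a : (chi a == 1) = (a == 0).
Proof.
have lt_ap : (a < p)%N by rewrite -[X in (_ < X)%N](Fp_cast p_prime).
rewrite -(prim_order_dvd z_prim); apply/idP/eqP => [|-> //].
move=> dv; apply/val_inj => /=; apply/eqP.
by move: dv; rewrite /dvdn modn_small.
Qed.

Lemma sum_chi c : \sum_(a : 'F_p) chi (a * c) = p%:R *+ (c == 0).
Proof.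
have [->|c0] := eqVneq c 0.
  rewrite (eq_bigr (fun=> 1)); last by move=> a _; rewrite mulr0.
  by rewrite sumr_const card_Fp.
have c1 : chi c != 1 by rewrite chi_eq1.
suff /eqP : (chi c - 1) * \sum_(a : 'F_p) chi (a * c) = 0.
  by rewrite mulf_eq0 subr_eq0 (negPf c1) => /eqP.
apply/eqP; rewrite mulrBl mul1r mulr_sumr subr_eq0; apply/eqP.
rewrite [RHS](reindex_inj (addIr 1)) /=.
by apply: eq_bigr => a _; rewrite mulrDl mul1r chiD mulrC.
Qed.

Lemma sum_chi1 : \sum_(a : 'F_p) chi a = 0.
Proof.
have := sum_chi 1; rewrite oner_eq0 mulr0n => s0; rewrite -[RHS]s0.
by apply: eq_bigr => a _; rewrite mulr1.
Qed.


(** Stated over any [D] because it serves both for [z] and for a primitive root in [algC]. *)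
Lemma root_cyclotomic_prime (D : numFieldType) (x : D) : p.-primitive_root x ->
  root (map_poly ratr (\poly_(i < p) 1 : {poly rat})) x.
Proof.
move=> x_prim.
have eqP1 : 'X^p - 1 = ('X - 1) * (\poly_(i < p) 1 : {poly rat}).
  rewrite subrX1 poly_def; congr (_ * _).
  by apply: eq_bigr => i _; rewrite scale1r.
have := congr1 (fun r => (map_poly (ratr : rat -> D) r).[x]) eqP1.
rewrite rmorphM !rmorphB /= map_polyXn map_polyX rmorph1 !hornerE.
rewrite (prim_expr_order x_prim) subrr => /esym/eqP; rewrite mulf_eq0.
case/orP => //; rewrite subr_eq0 => /eqP x1.
have := prim_order_dvd x_prim 1; rewrite x1 expr1n eqxx dvdn1.
by move=> /eqP p1; move: p_prime; rewrite p1.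
Qed.

(* The minimal polynomial of a primitive root of unity is only available over
   algC; gcds of rational polynomials carry its irreducibility over to C. *)
Lemma dvdp_cyclotomic (q : {poly rat}) :
  root (map_poly ratr q) z -> (\poly_(i < p) 1) %| q.
Proof.
have [y y_prim] := C_prim_root_exists (prime_gt0 p_prime).
have [m [Dm _ mP]] := minCpolyP y.
have size_m : size m = p.
  rewrite -(size_map_poly (ratr : {rmorphism rat -> algC})) -Dm.
  rewrite (minCpoly_cyclotomic y_prim) size_cyclotomic totient_prime //.
  by rewrite prednK ?prime_gt0.
have sF : size (\poly_(i < p) 1 : {poly rat}) = p.
  by rewrite size_poly_eq // oner_eq0.
have mF : m %= \poly_(i < p) 1.
  by rewrite -dvdp_size_eqp -?mP ?root_cyclotomic_prime // size_m sF.
set F := \poly_(i < p) 1 in sF mF * => qz.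
have F0 : F != 0 by rewrite -size_poly_eq0 sF -lt0n prime_gt0.
have [d Dd] := dvdpP _ _ (dvdp_gcdl F q).
have := root_cyclotomic_prime y_prim.
rewrite -/F {1}Dd rmorphM rootM !mP !(eqp_dvdl _ mF).
case/orP => [Fd | /dvdp_trans->//]; last exact: dvdp_gcdr.
have d0 : d != 0 by apply: contraNneq F0 => d0; rewrite Dd d0 mul0r.
have g0 : gcdp F q != 0 by rewrite gcdp_eq0 negb_and F0.
have gz : root (map_poly ratr (gcdp F q)) z.
  by rewrite gcdp_map root_gcd root_cyclotomic_prime.
have gz0 : map_poly (ratr : rat -> C) (gcdp F q) != 0 by rewrite map_poly_eq0.
have := root_size_gt1 gz0 gz; rewrite size_map_poly.
have := dvdp_leq d0 Fd; rewrite {1}Dd size_mul //.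
have := size_poly_gt0 d; rewrite d0.
case: (size (gcdp F q)) (size d) => // [[|k]] // [|l] // _.
by rewrite addnS /= addnS ltnNge leq_addr.
Qed.

(** The polynomial with coefficients [c] has degree below p and is divisible by 1 + X + ... +
    X^(p-1), so the quotient is a constant. *)
Lemma chi_indep (c : 'F_p -> int) :
  \sum_(k : 'F_p) (c k)%:~R * chi k = 0 -> forall j k, c j = c k.
Proof.
move=> c0.
pose q : {poly rat} := \poly_(i < p) (c i%:R)%:~R.
have /dvdp_cyclotomic : root (map_poly ratr q) z.
  have -> : map_poly ratr q = \poly_(i < p) (c i%:R)%:~R :> {poly C}.
    apply/polyP => i; rewrite coef_map !coef_poly.
    by case: ifP => _; [exact: ratr_int | exact: raddf0].
  apply/rootP; rewrite horner_poly -[RHS]c0.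
  rewrite -(big_mkord xpredT (fun i => (c i%:R)%:~R * z ^+ i)).
  rewrite -{1}(Fp_cast p_prime) big_mkord; apply: eq_bigr => k _.
  by rewrite natr_Zp.
have sF : size (\poly_(i < p) 1 : {poly rat}) = p.
  by rewrite size_poly_eq // oner_eq0.
move=> /dvdpP [d Dd].
suff [a Da] : exists a, d = a%:P.
  suff ca k : (c k)%:~R = a :> rat.
    by move=> j k; apply: (@intr_inj rat); rewrite !ca.
  have lt_kp : (k < p)%N by rewrite -[X in (_ < X)%N](Fp_cast p_prime).
  have := congr1 (fun r : {poly rat} => r`_k) Dd.
  by rewrite Da mul_polyC coefZ !coef_poly lt_kp natr_Zp mulr1.
exists d`_0; apply: size1_polyC.
have := size_poly p (fun i => (c i%:R)%:~R : rat).
rewrite -/q Dd; have [->|d0] := eqVneq d 0; first by rewrite size_poly0.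
rewrite size_mul // -?size_poly_eq0 ?sF -?lt0n ?prime_gt0 //.
rewrite -[p in X in (X <= _)%N -> _](prednK (prime_gt0 p_prime)) addnS /=.
rewrite -{2}(prednK (prime_gt0 p_prime)).
by rewrite -[in X in (_ <= X)%N -> _]add1n leq_add2r.
Qed.

End AdditiveCharacter.

(** * Galois conjugation and parity of character sums *)

Section CharacterSums.
Variables (C : numClosedFieldType) (p : nat) (z : C).
Hypotheses (p_prime : prime p) (z_prim : p.-primitive_root z).
Local Notation chi := (@addchar C p z).

Lemma chi1 : chi 1 = z.
Proof. by rewrite -[1]/(1%:R) (chi_nat p_prime z_prim). Qed.

(** The coefficients are all equal, and multiplication by [t] permutes the exponents; this stands in
    for the automorphism z -> z^t. *)
Lemma chi_indep_scale (c : 'F_p -> int) (t : 'F_p) : t != 0 ->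
  \sum_(k : 'F_p) (c k)%:~R * chi k = 0 ->
  \sum_(k : 'F_p) (c k)%:~R * chi (t * k) = 0.
Proof.
move=> t0 /(chi_indep p_prime z_prim) c0.
rewrite (eq_bigr (fun k => (c 0)%:~R * chi (t * k))); last first.
  by move=> k _; rewrite (c0 k 0).
have := sum_chi1 p_prime z_prim.
by rewrite (reindex_inj (mulfI t0)) -mulr_sumr => ->; rewrite mulr0.
Qed.

Lemma sum_chi_level (T : finType) (A : pred T) (phi : T -> 'F_p) (t : 'F_p) :
  \sum_(x | A x) chi (t * phi x) =
  \sum_(k : 'F_p) (#|[pred x | A x & phi x == k]| : int)%:~R * chi (t * k).
Proof.
rewrite (partition_big phi xpredT) //=; apply: eq_bigr => k _.
rewrite (eq_bigr (fun=> chi (t * k))); last by move=> x /andP[_ /eqP->].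
by rewrite sumr_const pmulrn mulrzl.
Qed.

(* The rational relation between the left and right sides, being a multiple of
   the cyclotomic polynomial, survives replacing z by z ^ t. *)
Lemma chi_galois (T : finType) (A : pred T) (phi : T -> 'F_p) (s : int)
    (k t : 'F_p) : t != 0 ->
  \sum_(x | A x) chi (phi x) = s%:~R * chi k ->
  \sum_(x | A x) chi (t * phi x) = s%:~R * chi (t * k).
Proof.
move=> t0 eq_k.
pose c j : int := (#|[pred x | A x & phi x == j]| : int) - s * (j == k).
have sumc u : \sum_(j : 'F_p) (c j)%:~R * chi (u * j) =
    \sum_(x | A x) chi (u * phi x) - s%:~R * chi (u * k).
  rewrite sum_chi_level.
  rewrite (bigD1 k) //= [X in _ = X - _](bigD1 k) //= addrAC -mulrBl.
  congr (_ * _ + _); first by rewrite /c eqxx mulr1 rmorphB.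
  by apply: eq_bigr => j /negPf jk; rewrite /c jk mulr0 subr0.
apply/eqP; rewrite -subr_eq0 -sumc chi_indep_scale //.
have := sumc 1; rewrite (eq_bigr (fun j => (c j)%:~R * chi j)) => [->|j _].
  under eq_bigr do rewrite mul1r.
  by rewrite mul1r eq_k subrr.
by rewrite mul1r.
Qed.

(* Modulo 2, equality of the two sides would make the coefficient vector
   e_a + e_b constant. *)
Lemma chi_parity (T : finType) (A : pred T) (phi : T -> 'F_p) (s u : int)
    (a b : 'F_p) : odd p -> odd `|s| -> 
  2 * (\sum_(x | A x) chi (phi x)) = s%:~R * chi a - u%:~R * chi b -> a = b.
Proof.
move=> p_odd s_odd E; apply/eqP; apply: contraT => ab.
pose N k := #|[pred x | A x & phi x == k]|.
pose c k : int := 2 * (N k : int) - s * (k == a) + u * (k == b).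
have /(chi_indep p_prime z_prim) cc : \sum_(k : 'F_p) (c k)%:~R * chi k = 0.
  have := sum_chi_level A phi 1.
  under eq_bigr do rewrite mul1r; move=> sA.
  rewrite (eq_bigr (fun k => 2 * ((N k : int)%:~R * chi (1 * k))
     - (s%:~R * chi k * (k == a)%:R) + (u%:~R * chi k * (k == b)%:R))).
    rewrite !big_split /= -mulr_sumr -sA E sumrN.
    rewrite (bigD1 a) //= eqxx mulr1 big1 ?addr0 => [|k /negPf->];
      rewrite ?mulr0 //.
    rewrite (bigD1 b) //= eqxx mulr1 big1 ?addr0 => [|k /negPf->];
      rewrite ?mulr0 //.
    by rewrite addrAC subrK subrr.
  move=> k _; rewrite /c mul1r rmorphD rmorphB !rmorphM /= -!pmulrn; ring.
have [k /andP [ka kb]] : exists k, (k != a) && (k != b).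
  case: (pickP (fun k => (k != a) && (k != b))) => [k|all_ab].
    by exists k.
  have : (#|[set: 'F_p]| <= #|[set a; b]|)%N.
    apply/subset_leq_card/subsetP => k _; rewrite !inE.
    by rewrite -[_ || _]negbK negb_or all_ab.
  by rewrite cardsT card_Fp // cards2 ab leqNgt odd_prime_gt2.
(* Constancy of [c] at [a] and at the third index [k] would make [s] even. *)
have eq_s : s = 2 * (Posz (N a) - Posz (N k)).
  move/eqP: (cc a k); rewrite /c eqxx (negPf ka) (negPf kb) (negPf ab).
  rewrite mulr1 !mulr0 subr0 !addr0 subr_eq => /eqP eqN.
  by rewrite mulrBr eqN addrC addKr.
by move: s_odd; rewrite eq_s abszM oddM.
Qed.

End CharacterSums.

(** * Elements of Z[z] of norm p ^ 2m *)

Section CyclotomicIntegers.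
Variables (C : numClosedFieldType) (p : nat) (z : C).
Hypotheses (p_prime : prime p) (z_prim : p.-primitive_root z).
Local Notation chi := (@addchar C p z).

(** The ring Z[z]. Presenting its elements as values of integer polynomials gives the Horner
    induction [cint_ind]. *)
Definition cint (x : C) : Prop :=
  exists q : {poly int}, x = (map_poly intr q).[z].

Lemma cint_int (k : int) : cint k%:~R.
Proof. by exists k%:P; rewrite map_polyC hornerC. Qed.

Lemma cint_nat (k : nat) : cint k%:R.
Proof. by rewrite pmulrn; apply: cint_int. Qed.

Lemma cintD x y : cint x -> cint y -> cint (x + y).
Proof. by move=> [q ->] [r ->]; exists (q + r); rewrite rmorphD hornerD. Qed.

Lemma cintN x : cint x -> cint (- x).
Proof. by move=> [q ->]; exists (- q); rewrite rmorphN hornerN. Qed.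

Lemma cintB x y : cint x -> cint y -> cint (x - y).
Proof. by move=> cx cy; apply/cintD/cintN. Qed.

Lemma cintM x y : cint x -> cint y -> cint (x * y).
Proof. by move=> [q ->] [r ->]; exists (q * r); rewrite rmorphM hornerM. Qed.

Lemma cintX x k : cint x -> cint (x ^+ k).
Proof.
move=> cx; elim: k => [|k IHk]; first exact: (cint_nat 1).
by rewrite exprS; apply: cintM.
Qed.

Lemma cint_root : cint z.
Proof. by exists 'X; rewrite map_polyX hornerX. Qed.

Lemma cint_sum (I : Type) (r : seq I) (P : pred I) (F : I -> C) :
  (forall i, P i -> cint (F i)) -> cint (\sum_(i <- r | P i) F i).
Proof.
by move=> cF; apply: big_ind => //; [apply: (cint_nat 0) | apply: cintD].
Qed.

Lemma cint_ind (P : C -> Prop) : (forall k : int, P k%:~R) ->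
  (forall x (k : int), cint x -> P x -> P (x * z + k%:~R)) ->
  forall x, cint x -> P x.
Proof.
move=> P0 PS x [q ->]; elim/poly_ind: q => [|q c Pq].
  by rewrite map_poly0 horner0; apply: (P0 0).
rewrite rmorphD rmorphM /= map_polyX map_polyC hornerD hornerMX hornerC.
by apply: PS => //; exists q.
Qed.

Lemma conj_root : z^* = z^-1.
Proof. by rewrite -(chi1 p_prime z_prim) conj_chi // chiN. Qed.

Lemma root_neq0 : z != 0.
Proof. by rewrite (prim_root_eq0 z_prim) -lt0n prime_gt0. Qed.

Lemma cint_conj x : cint x -> cint x^*.
Proof.
elim/cint_ind => [k|{}x k cx cxJ]; first by rewrite rmorph_int; apply: cint_int.
rewrite rmorphD rmorphM /= rmorph_int; apply/cintD/cint_int/cintM => //.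
rewrite conj_root -(mul1r z^-1) -(prim_expr_order z_prim).
rewrite -(prednK (prime_gt0 p_prime)) exprSr mulfK ?root_neq0 //.
exact: cintX cint_root.
Qed.

(** The p powers of z span Z[z] but add up to 0, so coordinates are determined only up to a common
    additive constant; [cint_unit_norm] exploits this freedom. *)
Lemma cint_coord x : cint x ->
  exists b : 'F_p -> int, x = \sum_k (b k)%:~R * chi k.
Proof.
have delta (k : int) : \sum_(j : 'F_p) (k * (j == 0))%:~R * chi j = k%:~R.
  rewrite (bigD1 0) // eqxx !mulr1 big1 /= ?addr0 // => j /negPf->.
  by rewrite mulr0 mul0r.
elim/cint_ind => [k|{}x k _ [b ->]].
  by exists (fun j => k * (j == 0)); rewrite delta.
exists (fun j => b (j - 1) + k * (j == 0)).
under [RHS]eq_bigr do rewrite rmorphD mulrDl.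
rewrite big_split /= delta; congr (_ + _).
rewrite mulr_suml [RHS](reindex_inj (addIr 1)); apply: eq_bigr => j _.
by rewrite addrK chiD // chi1 // mulrA.
Qed.

(** * Divisibility in Z[z] and the prime 1 - z *)

Definition cdiv (a b : C) : Prop := exists2 y, cint y & b = a * y.

Lemma cdiv_refl a : cdiv a a.
Proof. by exists 1; [exact: (cint_nat 1) | rewrite mulr1]. Qed.

Lemma cdivM a b c d : cdiv a b -> cdiv c d -> cdiv (a * c) (b * d).
Proof.
by move=> [x cx ->] [y cy ->]; exists (x * y); [exact: cintM | rewrite mulrACA].
Qed.

Lemma cdivMr a b c : cint c -> cdiv a b -> cdiv a (b * c).
Proof.
by move=> cc [x cx ->]; exists (x * c); [exact: cintM | rewrite mulrA].
Qed.

Lemma cdivD a b c : cdiv a b -> cdiv a c -> cdiv a (b + c).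
Proof.
by move=> [x cx ->] [y cy ->]; exists (x + y); [exact: cintD | rewrite mulrDr].
Qed.

Lemma cdivN a b : cdiv a b -> cdiv a (- b).
Proof. by move=> [x cx ->]; exists (- x); [exact: cintN | rewrite mulrN]. Qed.

Lemma cdiv_trans b a c : cdiv a b -> cdiv b c -> cdiv a c.
Proof.
by move=> [x cx ->] [y cy ->]; exists (x * y); [exact: cintM | rewrite mulrA].
Qed.

Lemma cdivX a b k : cdiv a b -> cdiv (a ^+ k) (b ^+ k).
Proof.
move=> ab; elim: k => [|k IHk]; first exact: cdiv_refl.
by rewrite !exprS; apply: cdivM.
Qed.

(** The quotient is a geometric sum. Used with j = 1, and with j * k congruent to 1 modulo p, it
    makes 1 - z^j and 1 - z divide each other. *)
Lemma cdiv_cyclotomic_unit j k : cdiv (1 - z ^+ j) (1 - z ^+ (j * k)).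
Proof.
exists (\sum_(i < k) (z ^+ j) ^+ i).
  by apply: cint_sum => i _; do 2!apply: cintX; apply: cint_root.
by rewrite exprM -!(opprB _ 1) subrX1 mulNr.
Qed.

(** Evaluate (X^p - 1) / (X - 1) at 1, once as a product over the nontrivial roots and once as a
    geometric sum. *)
Lemma prod_cyclotomic_prime : \prod_(1 <= j < p) (1 - z ^+ j) = p%:R.
Proof.
have := factor_Xn_sub_1 z_prim; rewrite big_ltn ?prime_gt0 // expr0 subrX1.
move/(mulfI (monic_neq0 (monicXsubC 1))) => /(congr1 (fun q => q.[1])).
rewrite horner_prod horner_sum => E.
rewrite (eq_bigr _ (fun j _ => esym (hornerXsubC (z ^+ j) 1))) E.
rewrite (eq_bigr (fun=> 1)) => [|i _]; first by rewrite sumr_const card_ord.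
by rewrite hornerXn expr1n.
Qed.

Local Notation lam := (1 - z).

Lemma cdiv_lam_p : cdiv (lam ^+ p.-1) p%:R.
Proof.
rewrite -prod_cyclotomic_prime -subn1 -prodr_const_nat.
apply: (big_ind2 cdiv) => [|a b c d|j _]; [exact: cdiv_refl | exact: cdivM |].
by have := cdiv_cyclotomic_unit 1 j; rewrite expr1 mul1n.
Qed.

Lemma cdiv_p_lam : cdiv p%:R (lam ^+ p.-1).
Proof.
rewrite -prod_cyclotomic_prime -subn1 -prodr_const_nat.
rewrite big_nat_cond [X in cdiv _ X]big_nat_cond.
apply: (big_ind2 cdiv) => [|a b c d|j]; [exact: cdiv_refl | exact: cdivM |].
rewrite andbT => /andP[j0 jp].
have jF0 : (j%:R : 'F_p) != 0.
  by rewrite -val_eqE /= val_Fp_nat // modn_small // -lt0n.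
(* Taking k to be the inverse of j modulo p gives z^(j * k) = z. *)
have := cdiv_cyclotomic_unit j ((j%:R : 'F_p)^-1 : 'F_p).
rewrite -(chi_nat p_prime z_prim (j * _)) natrM natr_Zp mulfV // chi1 //.
Qed.

(** Since z is 1 modulo 1 - z, every residue class contains an integer. *)
Lemma cint_mod_lam x : cint x ->
  exists2 k : int, cint k%:~R & cdiv lam (x - k%:~R).
Proof.
elim/cint_ind => [k|{}x k cx [j cj ljx]].
  exists k; first exact: cint_int.
  by rewrite subrr; exists 0; [exact: (cint_nat 0) | rewrite mulr0].
exists (j + k); first exact: cint_int.
have -> : x * z + k%:~R - (j + k)%:~R = (x - j%:~R) - lam * x.
  by rewrite rmorphD /=; ring.
apply: cdivD => //; apply/cdivN; exists x => //.
Qed.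

(** If p * x = 1, the coordinates of p * x and of 1 differ by a constant, so p * (b 0 - b 1) = 1,
    which is impossible. *)
Lemma cdiv_p1 : ~ cdiv p%:R 1.
Proof.
move=> [x /cint_coord [b ->] /eqP]; rewrite eq_sym -subr_eq0 => /eqP E.
have /(chi_indep p_prime z_prim)/(_ 0 1) :
    \sum_(k : 'F_p) (Posz p * b k - Posz (k == 0))%:~R * chi k = 0.
  rewrite -[RHS]E mulr_sumr.
  rewrite (eq_bigr (fun k => p%:R * ((b k)%:~R * chi k) - (k == 0)%:R * chi k)).
    rewrite sumrB; congr (_ - _); rewrite (bigD1 0) // eqxx mul1r.
    by rewrite big1 /= ?addr0 // => k /negPf->; rewrite mul0r.
  by move=> k _; rewrite rmorphB rmorphM /= -!pmulrn; ring.
rewrite eqxx oner_eq0 subr0 => /eqP; rewrite subr_eq addrC -subr_eq -mulrBr.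
move/eqP/(congr1 absz); rewrite abszM => /eqP.
rewrite muln_eq1 => /andP[/eqP p1 _].
by move: p_prime; rewrite (p1 : p = 1%N).
Qed.

Lemma cdiv_lam1 : ~ cdiv lam 1.
Proof.
move=> /(cdivX p.-1); rewrite expr1n => l1.
exact: cdiv_p1 (cdiv_trans cdiv_p_lam l1).
Qed.

Lemma cdiv_lam_p1 : cdiv lam p%:R.
Proof.
apply: cdiv_trans cdiv_lam_p; rewrite -(subnKC (prime_gt1 p_prime)) /= exprS.
apply: cdivMr (cdiv_refl _).
exact/cintX/cintB/cint_root/(cint_nat 1).
Qed.

(** Otherwise a Bezout relation between p and k makes 1 - z, which divides both, divide 1. *)
Lemma cdiv_lam_int (k : int) : cdiv lam k%:~R -> (p %| k)%Z.
Proof.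
move=> lk; apply/negPn/negP; rewrite dvdzE /= => pk.
have cop : coprimez p k by rewrite coprimezE /= prime_coprime.
have [u [v uv]] := Bezoutz p k.
apply: cdiv_lam1; have E : 1 = p%:R * u%:~R + k%:~R * v%:~R :> C.
  have := congr1 (fun i : int => i%:~R : C) uv.
  rewrite (eqP cop) rmorphD !rmorphM /= => uv1; rewrite -[LHS]uv1.
  by rewrite -pmulrn mulrC [k%:~R * _]mulrC.
rewrite [X in cdiv _ X]E.
by apply: cdivD; apply: cdivMr (cint_int _) _ => //; apply: cdiv_lam_p1.
Qed.

Lemma lam_neq0 : lam != 0.
Proof.
rewrite subr_eq0 eq_sym -[X in X == _](chi1 p_prime z_prim).
by rewrite (chi_eq1 p_prime z_prim) oner_eq0.
Qed.

Lemma lam_conj : lam^* * - z = lam.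
Proof.
rewrite rmorphB rmorph1 /= conj_root mulrBl mul1r mulrN mulVf ?root_neq0 //.
ring.
Qed.

(* lam is a prime of Z[z] fixed by conjugation up to a unit. *)
Lemma cdiv_lam_norm x : cint x -> cdiv lam (x * x^*) -> cdiv lam x.
Proof.
move=> cx lx; have [k _ [y cy /eqP]] := cint_mod_lam cx.
rewrite subr_eq => /eqP Dx.
suff lk : cdiv lam k%:~R.
  by rewrite Dx; apply: cdivD => //; apply: cdivMr (cdiv_refl _).
have llJ : cdiv lam (lam^*).
  exists (- z^*); first by apply/cintN/cint_conj/cint_root.
  rewrite -[X in _ = X * _]lam_conj conj_root mulrN mulrN mulNr opprK.
  by rewrite -mulrA mulfV ?mulr1 ?root_neq0.
have : cdiv lam (k * k)%:~R.
  have -> : (k * k)%:~R =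
      x * x^* - lam * (y * x^*) - lam^* * (k%:~R * y^*) :> C.
    by rewrite Dx !rmorphD !rmorphM /= !rmorph_int; ring.
  have cxJ := cint_conj cx; have cyJ := cint_conj cy.
  apply: cdivD; first apply: cdivD => //; apply/cdivN/cdivMr => //.
  - exact: cintM.
  - exact: cdiv_refl.
  - exact/cintM/cyJ/cint_int.
move/cdiv_lam_int; rewrite dvdzE abszM Euclid_dvdM // orbb => /dvdnP [m Dm].
suff [l ->] : exists l : int, k = p%:Z * l.
  by rewrite rmorphM; apply: cdivMr (cint_int _) _; apply: cdiv_lam_p1.
have /dvdzP [l ->] : (p %| k)%Z by rewrite dvdzE; apply/dvdnP; exists m.
by exists l; rewrite mulrC.
Qed.

(** Induction removes one factor 1 - z from x and two from its norm, because the conjugate of 1 - z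
    is 1 - z times a unit. *)
Lemma cdiv_lam_exp x k : cint x -> cdiv (lam ^+ (2 * k)) (x * x^*) ->
  cdiv (lam ^+ k) x.
Proof.
move=> cx; elim: k => [|k IHk] lx.
  by exists x => //; rewrite expr0 mul1r.
have lJ0 : lam^* != 0 by rewrite conjC_eq0 lam_neq0.
have cz := cint_root.
case: lx => v cv Dv.
have [|y cy Dx] := IHk.
  rewrite Dv mulnS addnC exprD -mulrA; apply: cdivMr (cdiv_refl _).
  by apply: cintM => //; apply/cintX/cintB => //; apply: (cint_nat 1).
suff [w cw Dw] : cdiv lam y.
  by exists w => //; rewrite Dx Dw exprSr mulrA.
apply: cdiv_lam_norm => //; exists (lam * v * (- z) ^+ k).
  apply: cintM (cintX _ (cintN cz)); apply: cintM => //.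
  exact: cintB (cint_nat 1) _.
apply: (mulfI (expf_neq0 (2 * k) lam_neq0)).
have -> : lam ^+ (2 * k) * (y * y^*) =
    (lam ^+ k * y) * (lam ^+ k * y)^* * (- z) ^+ k.
  have -> : lam ^+ (2 * k) = lam ^+ k * ((lam^*) ^+ k * (- z) ^+ k).
    by rewrite -exprMn lam_conj -exprD mul2n addnn.
  rewrite rmorphM rmorphXn /=.
  rewrite -!mulrA; congr (_ * _); rewrite [RHS]mulrCA; congr (_ * _).
  by rewrite mulrC mulrA.
by rewrite -Dx Dv mulnS addnC exprD expr2; ring.
Qed.

(** By [chi_indep] the autocorrelation [A b] of the coordinates is a constant t plus the indicator
    of 0, so the square of the coordinate sum is p * t + 1 and the sum is 1 or -1 modulo p. After a
    common shift it is exactly 1 or -1, which forces t = 0; the squares of the coordinates then add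
    up to 1, and a single coordinate, 1 or -1, survives. *)
Lemma cint_unit_norm x : cint x -> x * x^* = 1 ->
  exists (s : bool) (j : 'F_p), x = (-1) ^+ s * chi j.
Proof.
move=> /cint_coord [b0 Dx] xx1.
pose A (b : 'F_p -> int) k := \sum_j b (k + j) * b j.
have normE b : x = \sum_k (b k)%:~R * chi k ->
    exists t, forall k, A b k = t + (k == 0)%:R.
  move=> {}Dx; exists (A b 0 - 1) => k.
  have corr : \sum_k (A b k)%:~R * chi k = x * x^*.
    rewrite Dx rmorph_sum mulr_sumr.
    under [LHS]eq_bigr do rewrite /A rmorph_sum mulr_suml.
    rewrite exchange_big; apply: eq_bigr => j _.
    rewrite mulr_suml [RHS](reindex_inj (addIr j)); apply: eq_bigr => i _.
    by rewrite !rmorphM /= !rmorph_int conj_chi // mulrACA -chiD // addrK.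
  have : \sum_k (A b k - (k == 0)%:R)%:~R * chi k = 0.
    under eq_bigr do rewrite rmorphB mulrBl.
    rewrite sumrB corr xx1 [X in _ - X](bigD1 0) // eqxx mul1r.
    rewrite [X in _ - (_ + X)]big1 => [|j /negPf->]; last by rewrite mul0r.
    by rewrite /= addr0 subrr.
  move/(chi_indep p_prime z_prim)/(_ k 0); rewrite eqxx => <-.
  by rewrite subrK.
have sumA b : \sum_k A b k = (\sum_k b k) ^+ 2.
  rewrite exchange_big expr2 mulr_sumr; apply: eq_bigr => j _.
  by rewrite -mulr_suml [in RHS](reindex_inj (addIr j)).
have sum_sq b t : (forall k, A b k = t + (k == 0)%:R) ->
    (\sum_k b k) ^+ 2 = p%:Z * t + 1.
  move=> At; rewrite -sumA (eq_bigr _ (fun k _ => At k)) big_split /=.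
  rewrite sumr_const card_Fp // [X in _ + X](bigD1 0) // eqxx.
  rewrite big1 /= => [|k /negPf-> //].
  by rewrite addr0 -[t *+ p]mulr_natl natz.
have [e [c [e2 sb]]] : exists e c : int,
    e ^+ 2 = 1 /\ \sum_k b0 k = e + p%:Z * c.
  have [t /sum_sq St] := normE b0 Dx.
  set S := \sum_k b0 k in St *.
  have : (p %| (S - 1) * (S + 1))%Z.
    by apply/dvdzP; exists t; rewrite -subr_sqr expr1n St addrK mulrC.
  rewrite dvdzE abszM Euclid_dvdM // => /orP [] pS.
    have /dvdzP [c Dc] : (p %| S - 1)%Z by [].
    exists 1, c; split; first by rewrite expr1n.
    by rewrite [p%:Z * c]mulrC -Dc addrC subrK.
  have /dvdzP [c Dc] : (p %| S + 1)%Z by [].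
  exists (-1), c; split; first by rewrite sqrrN expr1n.
  by rewrite [p%:Z * c]mulrC -Dc addrC addrK.
(* The shift by [c] leaves x unchanged, as the p powers of z add up to 0, and brings the coordinate
   sum to [e]. *)
pose b k := b0 k - c.
have {}Dx : x = \sum_k (b k)%:~R * chi k.
  under eq_bigr do rewrite rmorphB mulrBl.
  by rewrite sumrB -mulr_sumr (sum_chi1 p_prime z_prim) mulr0 subr0.
have sum_b : \sum_k b k = e.
  by rewrite sumrB sb sumr_const card_Fp // -mulr_natl natz addrK.
have [t At] := normE b Dx.
have t0 : t = 0.
  have /eqP := sum_sq b t At; rewrite sum_b e2 eq_sym -subr_eq0 addrK mulf_eq0.
  by case/orP => [|/eqP//]; rewrite -[_ == 0]/(p == 0)%N eqn0Ngt prime_gt0.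
have sum_b2 : \sum_k b k ^+ 2 = 1.
  transitivity (A b 0); last by rewrite At t0 eqxx add0r.
  by apply: eq_bigr => k _; rewrite add0r expr2.
have [j bj] : exists j, b j != 0.
  case: (pickP (fun j => b j != 0)) => [j|b_0]; first by exists j.
  move: sum_b2; rewrite big1 // => k _.
  by have /negbFE/eqP-> := b_0 k; rewrite expr0n.
have bj1 : 1 <= b j ^+ 2 by rewrite -gtz0_ge1 exprn_even_gt0 //= bj orbT.
have b_other k : k != j -> b k = 0.
  move=> kj; apply/eqP; rewrite -sqrf_eq0; apply/eqP.
  have := sum_b2; rewrite (bigD1 j) //= (bigD1 k) //= => sumjk.
  apply/eqP; rewrite eq_le sqr_ge0 andbT.
  have : 0 <= \sum_(i | (i != j) && (i != k)) b i ^+ 2.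
    by apply: sumr_ge0 => i _; apply: sqr_ge0.
  move: bj1 sumjk; move: (b j ^+ 2) (b k ^+ 2) (bigop.body _ _ _) => u v w.
  lia.
have {}bj1 : b j ^+ 2 = 1.
  rewrite -sum_b2 (bigD1 j) //= big1 ?addr0 // => k /b_other->.
  by rewrite expr0n.
have Dxj : x = (b j)%:~R * chi j.
  by rewrite Dx (bigD1 j) //= big1 ?addr0 // => k /b_other->; rewrite mul0r.
move/eqP: bj1; rewrite sqrf_eq1 => /orP [] /eqP bj1.
  by exists false, j; rewrite Dxj bj1 expr0.
by exists true, j; rewrite Dxj bj1 expr1 rmorphN.
Qed.

(** As p and (1 - z)^(p-1) divide each other, the norm equation makes p^m divide x, and the quotient
    has norm 1. *)
Lemma cint_sqrt_norm m x : cint x -> x * x^* = p%:R ^+ (2 * m) ->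
  exists (s : bool) (j : 'F_p), x = (-1) ^+ s * p%:R ^+ m * chi j.
Proof.
move=> cx normx.
have p0 : p%:R != 0 :> C by rewrite pnatr_eq0 -lt0n prime_gt0.
have /cdiv_lam_exp [|y cy Dx] // : cdiv (lam ^+ (2 * (p.-1 * m))) (x * x^*).
  by rewrite normx mulnCA exprM; apply: cdivX; apply: cdiv_lam_p.
have [u cu Du] : cdiv (p%:R ^+ m) x.
  rewrite Dx; apply: cdivMr => //; rewrite exprM.
  exact/cdivX/cdiv_p_lam.
have /(cint_unit_norm cu) [s [j Dj]] : u * u^* = 1.
  apply: (mulfI (expf_neq0 (2 * m) p0)).
  rewrite mulr1 -[RHS]normx Du rmorphM rmorphXn /= rmorph_nat mulrACA -exprD.
  by rewrite addnn mul2n.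
by exists s, j; rewrite Du Dj mulrCA mulrA.
Qed.

End CyclotomicIntegers.

(** * Characters of F_p^n *)

Section Dot.
Variables (p n : nat).
Local Notation V := 'rV['F_p]_n.
Implicit Types x y : V.

Lemma dotC x y : dot x y = dot y x.
Proof. by apply: eq_bigr => i _; rewrite mulrC. Qed.

Lemma dotDr x y y' : dot x (y + y') = dot x y + dot x y'.
Proof. by rewrite -big_split; apply: eq_bigr => i _; rewrite mxE mulrDr. Qed.

Lemma dotZr (t : 'F_p) x y : dot x (t *: y) = t * dot x y.
Proof. by rewrite mulr_sumr; apply: eq_bigr => i _; rewrite mxE mulrCA. Qed.

Lemma dotDl x x' y : dot (x + x') y = dot x y + dot x' y.
Proof. by rewrite dotC dotDr ![dot y _]dotC. Qed.

Lemma dotZl (t : 'F_p) x y : dot (t *: x) y = t * dot x y.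
Proof. by rewrite dotC dotZr dotC. Qed.

Lemma dotNr x y : dot x (- y) = - dot x y.
Proof. by rewrite -scaleN1r dotZr mulN1r. Qed.

Lemma dotNl x y : dot (- x) y = - dot x y.
Proof. by rewrite dotC dotNr dotC. Qed.

Lemma dot0r x : dot x 0 = 0.
Proof. by rewrite -(scale0r 0) dotZr mul0r. Qed.

Lemma dot0l x : dot 0 x = 0.
Proof. by rewrite dotC dot0r. Qed.

Lemma dot_delta x i : dot x (delta_mx 0 i) = x 0 i.
Proof.
rewrite /dot (bigD1 i) //= mxE !eqxx mulr1 big1 ?addr0 // => j /negPf ji.
by rewrite mxE ji andbF mulr0.
Qed.

Lemma orthcP (A : {set V}) x :
  reflect (forall y, y \in A -> dot x y = 0) (x \in orthc A).
Proof.
rewrite inE; apply: (iffP forall_inP) => H y yA; first exact/eqP/H.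
by rewrite H.
Qed.

Lemma orthcT : orthc [set: V] = [set 0].
Proof.
apply/setP => x; apply/orthcP/set1P => [x0|-> y _]; last exact: dot0l.
by apply/rowP => i; rewrite mxE -dot_delta x0 ?inE.
Qed.

Lemma orthc0 (A : {set V}) : 0 \in orthc A.
Proof. by apply/orthcP => y _; rewrite dot0l. Qed.

End Dot.

(** Subspaces as sets, the form in which [Bminus] and [orthc] occur. *)
Definition subspace p n (A : {set 'rV['F_p]_n}) : Prop :=
  [/\ 0 \in A, forall x y, x \in A -> y \in A -> x + y \in A &
      forall (t : 'F_p) x, x \in A -> t *: x \in A].

Lemma subspaceT p n : subspace [set: 'rV['F_p]_n].
Proof. by split=> *; rewrite inE. Qed.

Lemma subspace_orthc p n (A : {set 'rV['F_p]_n}) : subspace (orthc A).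
Proof.
split=> [|x x' /orthcP xA /orthcP x'A|t x /orthcP xA]; first exact: orthc0.
  by apply/orthcP => y yA; rewrite dotDl xA // x'A // addr0.
by apply/orthcP => y yA; rewrite dotZl xA // mulr0.
Qed.

Lemma subspaceZ p n (A : {set 'rV['F_p]_n}) (t : 'F_p) x :
  subspace A -> t != 0 -> (t *: x \in A) = (x \in A).
Proof.
move=> [_ _ AZ] t0; apply/idP/idP => [tx|]; last exact: AZ.
by rewrite -[x]scale1r -(mulVf t0) -scalerA AZ.
Qed.

Lemma subspaceN p n (A : {set 'rV['F_p]_n}) x :
  subspace A -> (- x \in A) = (x \in A).
Proof.
by move=> sA; rewrite -scaleN1r subspaceZ // oppr_eq0 oner_eq0.
Qed.

Section Characters.
Variables (C : numClosedFieldType) (p : nat) (z : C) (n : nat).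
Hypotheses (p_prime : prime p) (z_prim : p.-primitive_root z).
Local Notation chi := (@addchar C p z).
Local Notation V := 'rV['F_p]_n.

Lemma sum_subspace (A : {set V}) a : subspace A ->
  \sum_(x in A) chi (dot a x) = #|A|%:R *+ (a \in orthc A).
Proof.
move=> [A0 AD AZ]; have [aA|] := boolP (a \in orthc A).
  rewrite (eq_bigr (fun=> 1)) ?sumr_const // => x xA.
  by rewrite (orthcP _ _ aA).
rewrite inE => /forall_inPn [y yA ay0]; apply/eqP.
have ay1 : chi (dot a y) != 1 by rewrite chi_eq1.
have : (chi (dot a y) - 1) * \sum_(x in A) chi (dot a x) = 0.
  apply/eqP; rewrite mulrBl mul1r mulr_sumr subr_eq0.
  rewrite [X in _ == X](reindex_inj (addIr y)) /=; apply/eqP.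
  apply: eq_big => [x|x xA]; last by rewrite dotDr chiD // mulrC.
  apply/idP/idP => [xA|xyA]; first exact: AD.
  by rewrite -(addrK y x) AD // -scaleN1r AZ.
by move/eqP; rewrite mulf_eq0 subr_eq0 (negPf ay1).
Qed.

(** Double counting: chi (dot a x) is summed over all a and all x in [A], in either order. *)
Lemma card_orthc (A : {set V}) : subspace A -> (#|A| * #|orthc A| = p ^ n)%N.
Proof.
move=> sA; apply/eqP; rewrite -(eqr_nat C) natrM; apply/eqP.
transitivity (\sum_a \sum_(x in A) chi (dot a x)).
  under eq_bigr do rewrite sum_subspace //.
  rewrite -[#|orthc A|%:R]sumr_const mulr_sumr.
  rewrite [RHS](bigID (mem (orthc A))) /=.
  rewrite [X in _ = _ + X]big1 ?addr0 => [|x /negPf->]; last by rewrite mulr0n.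
  by apply: eq_bigr => a ->; rewrite mulr1.
rewrite exchange_big (bigD1 0) /=; last by case: sA.
rewrite [X in _ + X]big1 ?addr0 => [|x /andP [_ x0]].
  under eq_bigr do rewrite dot0r.
  by rewrite sumr_const card_mx card_Fp // mul1n.
under eq_bigr do rewrite dotC.
transitivity (\sum_(a in [set: V]) chi (dot x a)).
  by apply: eq_bigl => a; rewrite inE.
by rewrite (sum_subspace _ (subspaceT p n)) orthcT inE (negPf x0).
Qed.

Lemma orthcK (A : {set V}) : subspace A -> orthc (orthc A) = A.
Proof.
move=> sA; apply/esym/eqP; rewrite eqEcard; apply/andP; split.
  apply/subsetP => x xA; apply/orthcP => y /orthcP/(_ x xA).
  by rewrite dotC.
have cA := card_orthc sA; have cA' := card_orthc (subspace_orthc A).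
have : (0 < #|orthc A|)%N by apply/card_gt0P; exists 0; apply: orthc0.
by move=> /leq_pmul2l <-; rewrite cA' -cA mulnC.
Qed.

Lemma sum_dot (a : V) : \sum_x chi (dot a x) = (p ^ n)%:R *+ (a == 0).
Proof.
transitivity (\sum_(x in [set: V]) chi (dot a x)).
  by apply: eq_bigl => x; rewrite inE.
rewrite (sum_subspace _ (subspaceT p n)) orthcT inE.
by rewrite cardsT card_mx card_Fp // mul1n.
Qed.

(** The Walsh transform for any primitive root z; for [z := xi R p] it is convertible to
    [walsh R f]. *)
Definition walsh_sum (f : V -> 'F_p) (a : V) : C := \sum_x chi (f x - dot a x).

Local Notation wsum := walsh_sum.

Lemma wsum_inv f y :
  \sum_a wsum f a * chi (dot a y) = (p ^ n)%:R * chi (f y).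
Proof.
under eq_bigr do rewrite mulr_suml.
rewrite exchange_big (bigD1 y) //=.
under eq_bigr do rewrite -chiD // subrK.
rewrite sumr_const card_mx card_Fp // mul1n mulr_natl big1 ?addr0 // => x xy.
under eq_bigr do rewrite -chiD // -addrA -dotNr -dotDr chiD // dotC.
by rewrite -mulr_sumr sum_dot [- x + y]addrC subr_eq0 eq_sym (negPf xy) mulr0.
Qed.

(* The number of z in the first fiber with w - z in the second is the inverse
   transform of a product of two functions that factor through k'. *)
Lemma fiber_convolution (I : eqType) (J : finType) (k : V -> I) (k' : V -> J)
    (u v : I) w w' :
  (forall x, k (- x) = k x) ->
  (forall i a b, k' a = k' b ->
     \sum_(x | k x == i) chi (dot a x) = \sum_(x | k x == i) chi (dot b x)) ->
  (forall j a b, k a = k b ->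
     \sum_(x | k' x == j) chi (dot a x) = \sum_(x | k' x == j) chi (dot b x)) ->
  k w = k w' ->
  #|[set x | (k x == u) && (k (w - x) == v)]| =
  #|[set x | (k x == u) && (k (w' - x) == v)]|.
Proof.
move=> kN kk' k'k kw.
pose eta i a := \sum_(x | k x == i) chi (dot a x).
have convE y : (p ^ n)%:R * #|[set x | (k x == u) && (k (y - x) == v)]|%:R =
    \sum_a eta u a * eta v a * chi (dot (- y) a).
  rewrite -sum1_card natr_sum mulr_sumr.
  under [RHS]eq_bigr do rewrite !mulr_suml.
  rewrite exchange_big.
  rewrite [LHS](eq_bigl (fun x => (k x == u) && (k (y - x) == v))); last first.
    by move=> x; rewrite inE.
  rewrite big_mkcondr; apply: eq_bigr => x _.
  under [RHS]eq_bigr do rewrite mulr_sumr mulr_suml.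
  rewrite exchange_big /=.
  (* Summing over the frequencies a leaves only t = y - x. *)
  have yx t : \sum_a chi (dot a x) * chi (dot a t) * chi (dot (- y) a) =
      (p ^ n)%:R *+ (t == y - x).
    under eq_bigr do rewrite -!chiD // [dot (- y) _]dotC -!dotDr dotC.
    by rewrite sum_dot subr_eq0 addrC eq_sym -subr_eq eq_sym.
  under [RHS]eq_bigr do rewrite yx.
  case: ifP => kv.
    rewrite (bigD1 (y - x)) //= eqxx mulr1 big1 ?addr0 // => t.
    by move=> /andP [_ /negPf->].
  by rewrite big1 // => t kt; case: eqP => // ty; rewrite -ty kt in kv.
have q0 : (p ^ n)%:R != 0 :> C by rewrite pnatr_eq0 -lt0n expn_gt0 prime_gt0.
apply/eqP; rewrite -(eqr_nat C); apply/eqP/(mulfI q0).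
(* Frequencies are grouped by [k']: [eta u] and [eta v] are constant on each group, and what remains
   depends on w only through [k (- w)]. *)
rewrite !convE !(partition_big k' xpredT) //=; apply: eq_bigr => j _.
case: (pickP (fun a => k' a == j)) => [a0 /eqP ka0|no]; last first.
  by rewrite !big_pred0.
have etaE y : \sum_(a | k' a == j) eta u a * eta v a * chi (dot (- y) a) =
    eta u a0 * eta v a0 * \sum_(a | k' a == j) chi (dot (- y) a).
  rewrite mulr_sumr; apply: eq_bigr => a /eqP ka.
  by rewrite /eta !(kk' _ a a0) ?ka ?ka0.
by rewrite !etaE (k'k j (- w) (- w')) // !kN.
Qed.

End Characters.

(** * Schemes from labelled translation classes *)

Section LabelledScheme.
Variables (T : finType) (I : eqType) (k : T -> I).

Lemma partition_fibers (s : seq I) :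
  (forall x, k x \in s) -> {in s, forall i, exists x, k x = i} ->
  partition [set:: [seq [set x | k x == i] | i <- s]] [set: T].
Proof.
move=> ks sk; suff -> : [set:: [seq [set x | k x == i] | i <- s]]
    = preim_partition k [set: T] by apply: preim_partitionP.
apply/setP => A; rewrite inE; apply/mapP/imsetP => [[i si ->]|[x _ ->]].
  have [x <-] := sk i si; exists x => //.
  by apply/setP => y; rewrite !inE eq_sym.
by exists (k x) => //; apply/setP => y; rewrite !inE eq_sym.
Qed.

Lemma uniq_fibers (s : seq I) : {in s, forall i, exists x, k x = i} ->
  uniq s -> uniq [seq [set x | k x == i] | i <- s].
Proof.
move=> sk us; rewrite map_inj_in_uniq // => i j si sj /setP eq_ij.
have [x kx] := sk i si; have := eq_ij x.
by rewrite !inE kx eqxx => /esym/eqP.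
Qed.

End LabelledScheme.

Section TranslationScheme.
Variables (p n : nat) (I : eqType) (k : 'rV['F_p]_n -> I) (s : seq I) (d : nat).
Local Notation V := 'rV['F_p]_n.
Hypotheses (size_s : size s = d.+1) (uniq_s : uniq s)
  (ks : forall x, k x \in s) (sk : {in s, forall i, exists x, k x = i})
  (s0 : nth (k 0) s 0 = k 0) (k0 : forall x, k x = k 0 -> x = 0)
  (kN : forall x, k (- x) = k x)
  (k_conv : forall u v w w', k w = k w' ->
     #|[set x | (k x == u) && (k (w - x) == v)]| =
     #|[set x | (k x == u) && (k (w' - x) == v)]|).

Lemma translation_scheme :
  is_partition [seq [set x | k x == i] | i <- s] /\
  induces_symmetric_scheme d [seq [set x | k x == i] | i <- s].
Proof.
set U := [seq _ | i <- s].
split; first by split; [exact: uniq_fibers | exact: partition_fibers].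
split; first by rewrite size_map.
pose lab (i : 'I_d.+1) := nth (k 0) s i.
have s_lab i : lab i \in s by rewrite mem_nth // size_s.
have labE x : exists i, lab i = k x.
  have ltx : (index (k x) s < d.+1)%N by rewrite -size_s index_mem.
  by exists (Ordinal ltx); rewrite /lab /= nth_index.
have SE (i : 'I_d.+1) : [set ab : V * V | ab.1 - ab.2 \in nth set0 U i] =
    [set ab | k (ab.1 - ab.2) == lab i].
  by apply/setP => ab; rewrite !inE (nth_map (k 0)) ?size_s // inE.
have lab_inj : injective lab.
  by move=> i j /eqP; rewrite nth_uniq ?size_s // => /eqP/val_inj.
have symS (i : 'I_d.+1) :
    transpose_rel [set ab : V * V | ab.1 - ab.2 \in nth set0 U i] =
    [set ab : V * V | ab.1 - ab.2 \in nth set0 U i].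
  by rewrite !SE; apply/setP => ab; rewrite !inE /= -opprB kN.
split; last exact: symS.
split.
- by apply/card_gt0P; exists 0.
- split.
    move=> i j /setP eq_ij; apply: lab_inj.
    have [x kx] := sk (s_lab i); have := eq_ij (x, 0).
    by rewrite !SE !inE /= subr0 kx eqxx => /esym/eqP.
  suff -> : [set [set ab : V * V | ab.1 - ab.2 \in nth set0 U i] | i : 'I_d.+1]
      = [set:: [seq [set ab : V * V | k (ab.1 - ab.2) == i] | i <- s]].
    apply: (partition_fibers (k := fun ab : V * V => k (ab.1 - ab.2))) => //.
    move=> i si.
    by have [x <-] := sk si; exists (x, 0); rewrite subr0.
  apply/setP => A; rewrite inE; apply/imsetP/mapP => [[i _ ->]|[i si ->]].
    by exists (lab i); rewrite ?SE.
  have [x kx] := sk si; have [j Dj] := labE x.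
  by exists j => //; rewrite SE Dj kx.
- rewrite SE /lab /= s0; apply/setP => ab; rewrite !inE -subr_eq0.
  by apply/eqP/eqP => [/k0 //|->].
- by move=> j; exists j.
(* A chosen element of each class; the [pick] succeeds because every label in [s] is attained. *)
pose rep w := odflt 0 [pick x | k x == lab w].
have k_rep w : k (rep w) = lab w.
  rewrite /rep; case: pickP => [x /eqP //|no_x].
  by have [x kx] := sk (s_lab w); have := no_x x; rewrite kx eqxx.
exists (fun u v w => #|[set x | (k x == lab u) && (k (rep w - x) == lab v)]|).
move=> u v w x y; rewrite SE inE /= => /eqP kxy.
rewrite (k_conv _ _ (etrans (k_rep w) (esym kxy))) !SE.
(* The bijection t = x - z turns the count for the pair (x, y) into that of the t with t and x - y -
   t in prescribed classes. *)
rewrite -(card_imset _ (inj_comp (addrI x) (@oppr_inj V))).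
congr #|pred_of_set _|; apply/setP => z; rewrite !inE /=.
apply/idP/imsetP => [/andP [kx ky]|[t]].
  exists (x - z); last by rewrite /= subKr.
  by rewrite inE kx opprB addrC addrA subrK.
by rewrite inE => /andP [kt ky] ->; rewrite /= subKr kt addrAC.
Qed.

End TranslationScheme.

(** * Character sums of the blocks *)

Section DualPair.
Variables (C : numClosedFieldType) (p : nat) (z : C) (n m r : nat).
Hypotheses (p_prime : prime p) (z_prim : p.-primitive_root z).
Hypothesis (n_eq : n = (2 * m)%N).
Local Notation chi := (@addchar C p z).
Local Notation wsum := (@walsh_sum C p z n).
Local Notation V := 'rV['F_p]_n.
Implicit Types (f g : V -> 'F_p) (L M : {set V}).

(* With L = B_-(f) and M = B_-(g), the setting of the theorem is
   dual_pair f g L M l h, which is symmetric under exchanging f and g. *)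
Record half_pair f g L l : Prop := HalfPair {
  wsumE : forall a, wsum f a = (-1) ^+ (a \in L) * p%:R ^+ m * chi (g a);
  dualN : forall a, g (- a) = g a;
  dual0 : g 0 = 0;
  dualZ : forall (t : 'F_p) a, t != 0 -> g (t *: a) = t ^+ l * g a;
  dual_space : subspace L;
  dual_card : #|L| = (p ^ r)%N }.

Definition dual_pair f g L M l h := half_pair f g L l /\ half_pair g f M h.

Lemma dual_pairC f g L M l h : dual_pair f g L M l h -> dual_pair g f M L h l.
Proof. by case. Qed.

(* Distinguishes the blocks of U3: c_j, B_-(f)^orth minus 0, the rest of d_0 and
   d_j have the labels listed in labels3 below. For r = n/2 + 1 the label
   (false, true, false, 0) does not occur and the same labels describe U2. *)
Definition label f M L (x : V) : bool * bool * bool * 'F_p :=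
  (x == 0, x \in M, x \in orthc L, f x).

Definition fiber f M L (i : bool * bool * bool * 'F_p) : {set V} :=
  [set x | label f M L x == i].

(** For b = g a this is the sum over t != 0 of chi (t * g (t^-1 *: a) - t * j), with the homogeneity
    of g of degree l already used. *)
Definition twist l (j b : 'F_p) : C :=
  \sum_(t : 'F_p | t != 0) chi (t * (t^-1 ^+ l * b) - t * j).

Let P_neq0 : p%:R ^+ m != 0 :> C.
Proof. by rewrite expf_neq0 // pnatr_eq0 -lt0n prime_gt0. Qed.

Let p_neq0 : p%:R != 0 :> C.
Proof. by rewrite pnatr_eq0 -lt0n prime_gt0. Qed.

Let q_eq : (p ^ n)%:R = p%:R ^+ m * p%:R ^+ m :> C.
Proof. by rewrite natrX n_eq mul2n -addnn exprD. Qed.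

Lemma wsum_sign_inv f g L x :
  (forall a, wsum f a = (-1) ^+ (a \in L) * p%:R ^+ m * chi (g a)) ->
  \sum_a (-1) ^+ (a \in L) * chi (g a - dot x a) = p%:R ^+ m * chi (f (- x)).
Proof.
move=> fg; apply: (mulfI P_neq0).
rewrite mulrA -q_eq -(wsum_inv p_prime z_prim) mulr_sumr.
apply: eq_bigr => a _; rewrite fg dotNr (dotC a) chiD //.
by rewrite !mulrA [p%:R ^+ m * _]mulrC.
Qed.

Section OnePair.
Variables (f g : V -> 'F_p) (L M : {set V}) (l h : nat).
Hypothesis fg : dual_pair f g L M l h.

(** Twice the sum over [L] is the plain sum over all a minus the sum weighted by the signs of W_f.
    The plain sum is the Walsh value of g at x, and the signed one is Fourier inversion for f. *)
Lemma sum_sub_dual x :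
  \sum_(a in L) chi (g a - dot x a) = - (x \in M)%:R * p%:R ^+ m * chi (f x).
Proof.
have [Hf Hg] := fg.
have allL : \sum_a chi (g a - dot x a) =
    (-1) ^+ (x \in M) * p%:R ^+ m * chi (f x).
  exact: wsumE Hg x.
have signL := wsum_sign_inv x (wsumE Hf); rewrite (dualN Hg) in signL.
have : 2 * \sum_(a in L) chi (g a - dot x a) =
    \sum_a chi (g a - dot x a) - \sum_a (-1) ^+ (a \in L) * chi (g a - dot x a).
  rewrite -sumrB [RHS](bigID (mem L)) /= [X in _ = _ + X]big1 ?addr0.
    rewrite mulr_sumr; apply: eq_bigr => a ->; rewrite expr1; ring.
  by move=> a /negPf->; rewrite expr0 mul1r subrr.
rewrite allL signL => E.
have n2 : 2 != 0 :> C by rewrite pnatr_eq0.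
by apply: (mulfI n2); rewrite E; case: (x \in M) => /=; ring.
Qed.

End OnePair.

Section LevelSums.
Variables (f g : V -> 'F_p) (L M : {set V}) (l h : nat).
Hypothesis fg : dual_pair f g L M l h.

(** For x orthogonal to [L] the sum in [sum_sub_dual] has the same value as at 0, namely -p^m; this
    forces x in [M] and chi (f x) = 1. *)
Lemma orthc_sub_dual x : x \in orthc L -> (x \in M) && (f x == 0).
Proof.
have [Hf Hg] := fg => /orthcP xL.
have := sum_sub_dual fg 0; have := sum_sub_dual fg x.
have -> : \sum_(a in L) chi (g a - dot x a) = \sum_(a in L) chi (g a - dot 0 a).
  by apply: eq_bigr => a aL; rewrite xL // dot0l.
move=> ->; rewrite (dual0 Hg) chi0 mulr1.
have [-> _ _] := dual_space Hg.
move=> E.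
have : (x \in M)%:R * chi (f x) = 1.
  apply: (mulfI P_neq0); apply: oppr_inj.
  by rewrite mulr1 -[RHS]mulN1r -E; ring.
case: (x \in M) => /= /eqP; last by rewrite mul0r eq_sym oner_eq0.
by rewrite mul1r chi_eq1.
Qed.

(** The condition f x = j is detected by averaging chi (t * (f x - j)) over t. For t != 0 the factor
    t is pulled out of the linear term as well, so that the inner sum is a conjugate of a Walsh-type
    sum at - t^-1 a. *)
Lemma level_sum (A : {pred V}) j a :
  p%:R * \sum_(x | A x && (f x == j)) chi (dot a x) =
  \sum_(x | A x) chi (dot a x) +
  \sum_(t : 'F_p | t != 0) chi (- (t * j)) *
    \sum_(x | A x) chi (t * (f x - dot (- (t^-1 *: a)) x)).
Proof.
transitivity (\sum_(t : 'F_p) chi (- (t * j)) *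
    \sum_(x | A x) chi (t * f x + dot a x)).
  under [RHS]eq_bigr do rewrite mulr_sumr.
  rewrite [RHS]exchange_big big_mkcondr mulr_sumr; apply: eq_bigr => x _ /=.
  under eq_bigr do rewrite -chiD // addrA [- (_ * j) + _]addrC -mulrBr chiD //.
  rewrite -mulr_suml sum_chi // subr_eq0; case: eqP => _; first by [].
  by rewrite mulr0 mul0r.
rewrite (bigD1 0) //= mul0r oppr0 chi0 mul1r; congr (_ + _).
  by apply: eq_bigr => x _; rewrite mul0r add0r.
apply: eq_bigr => t t0; congr (_ * _); apply: eq_bigr => x _.
by rewrite dotNl opprK mulrDr dotZl mulVKf.
Qed.

(** Each inner sum of [level_sum] is, by [chi_galois], conjugate to a Walsh value of f. Its sign
    does not vary with t because [L] is a subspace, and the integer factor p^m is fixed by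
    conjugation. *)
Lemma level_sum_all j a :
  p%:R * \sum_(x | f x == j) chi (dot a x) =
  (p ^ n)%:R *+ (a == 0) + (-1) ^+ (a \in L) * p%:R ^+ m * twist l j (g a).
Proof.
have [Hf Hg] := fg; have := level_sum predT j a; rewrite /= => ->.
rewrite sum_dot //; congr (_ + _); rewrite mulr_sumr; apply: eq_bigr => t t0.
have -> : (-1) ^+ (a \in L) * p%:R ^+ m =
    ((-1) ^+ (a \in L) * p%:Z ^+ m)%:~R :> C.
  by rewrite rmorphM !rmorphXn /= rmorphN1 -pmulrn.
rewrite (chi_galois p_prime z_prim t0 (k := t^-1 ^+ l * g a)
  (s := (-1) ^+ (a \in L) * p%:Z ^+ m)).
  by rewrite mulrCA -chiD // addrC.
rewrite -[LHS]/(wsum f _) (wsumE Hf) (dualN Hf) (dualZ Hf) ?invr_eq0 //.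
rewrite subspaceN ?subspaceZ ?invr_eq0 //; try exact: dual_space Hf.
by rewrite rmorphM !rmorphXn /= rmorphN1 -pmulrn.
Qed.

(** The computation is that of [level_sum_all], with [sum_sub_dual] for the exchanged pair in place
    of the Walsh values. *)
Lemma level_sum_sub j a :
  p%:R * \sum_(x in M | f x == j) chi (dot a x) =
  (p ^ r)%:R *+ (a \in orthc M) - (a \in L)%:R * p%:R ^+ m * twist l j (g a).
Proof.
have [Hf Hg] := fg; rewrite (level_sum (mem M)).
rewrite sum_subspace ?(dual_card Hg) //; last exact: dual_space Hg.
congr (_ + _); rewrite -!mulNr mulr_sumr; apply: eq_bigr => t t0.
have sE : - (a \in L)%:R * p%:R ^+ m = (- (a \in L)%:R * p%:Z ^+ m)%:~R :> C.
  by rewrite rmorphM rmorphN rmorphXn rmorph_nat /= -pmulrn.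
rewrite (chi_galois p_prime z_prim t0 (k := t^-1 ^+ l * g a)
  (s := - (a \in L)%:R * p%:Z ^+ m)).
  by rewrite sE mulrCA -chiD // addrC.
rewrite (sum_sub_dual (dual_pairC fg)) (dualN Hf) (dualZ Hf) ?invr_eq0 //.
rewrite (subspaceN _ (dual_space Hf)) (subspaceZ _ (dual_space Hf)) ?sE //.
by rewrite invr_eq0.
Qed.

Lemma label_zero : label f M L 0 = (true, true, true, 0).
Proof.
have [_ Hg] := fg; have [M0 _ _] := dual_space Hg.
by rewrite /label eqxx M0 orthc0 (dual0 Hg).
Qed.

Lemma labelE x b0 b1 b2 j : (label f M L x == (b0, b1, b2, j)) =
  [&& (x == 0) == b0, (x \in M) == b1, (x \in orthc L) == b2 & f x == j].
Proof. by rewrite /label !xpair_eqE -!andbA. Qed.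

Local Notation fiber := (fiber f M L).

Lemma fiber_zero : fiber (true, true, true, 0) = [set 0].
Proof.
apply/setP => x; rewrite inE in_set1; have [->|x0] := eqVneq x 0.
  by rewrite label_zero eqxx.
by rewrite labelE (negPf x0).
Qed.

Lemma fiber_out j : fiber (false, false, false, j) = [set x | f x == j] :\: M.
Proof.
apply/setP => x; rewrite inE labelE in_setD.
have [->|_] := eqVneq x 0.
  by have [-> _ _] := dual_space fg.2.
have [/orthc_sub_dual/andP [-> _]|_] := boolP (x \in orthc L); first by [].
by rewrite !inE; case: (x \in M).
Qed.

Lemma fiber_orthc : fiber (false, true, true, 0) = orthc L :\ 0.
Proof.
apply/setP => x; rewrite inE labelE in_setD1.
have [/orthc_sub_dual/andP [-> ->]|_] := boolP (x \in orthc L); last first.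
  by rewrite !andbF.
by case: (x == 0).
Qed.

Lemma fiber_sub0 :
  fiber (false, true, false, 0) = [set x in M | f x == 0] :\: orthc L.
Proof.
apply/setP => x; rewrite inE labelE in_setD.
have [->|_] := eqVneq x 0; first by rewrite orthc0.
have [_|_] := boolP (x \in orthc L); rewrite ?andbF //= !inE.
by case: (x \in M).
Qed.

Lemma fiber_sub j : j != 0 ->
  fiber (false, true, false, j) = [set x in M | f x == j].
Proof.
rewrite eq_sym => /negPf j0; apply/setP => x; rewrite inE labelE.
have [->|x0] := eqVneq x 0.
  by rewrite !inE (dual0 fg.2) j0 !andbF.
have [/orthc_sub_dual/andP [-> /eqP fx0]|_] := boolP (x \in orthc L).
  by rewrite !inE fx0 j0 !andbF.
by rewrite !inE; case: (x \in M).
Qed.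

(** The order is that of the blocks of [U3], so that mapping [fiber] over this list reproduces [U3]
    entry by entry. *)
Definition labels3 : seq (bool * bool * bool * 'F_p) :=
  (true, true, true, 0)
    :: [seq (false, false, false, j) | j <- enum 'F_p]
    ++ (false, true, true, 0)
    :: (false, true, false, 0)
    :: [seq (false, true, false, j) | j <- enum 'F_p & j != 0].

Lemma label_in x : label f M L x \in labels3.
Proof.
rewrite inE mem_cat 2!in_cons; have [->|x0] := eqVneq x 0.
  by rewrite label_zero eqxx.
apply/orP; right; rewrite /label (negPf x0).
have [/orthc_sub_dual/andP [-> /eqP->]|_] := boolP (x \in orthc L).
  by rewrite eqxx orbT.
have [xM|xM] := boolP (x \in M); last first.
  by apply/orP; left; apply/mapP; exists (f x); rewrite ?mem_enum.
have [-> | fx0] := eqVneq (f x) 0; first by rewrite eqxx !orbT.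
apply/orP; right; apply/orP; right; apply/orP; right.
by apply/mapP; exists (f x); rewrite // mem_filter fx0 mem_enum.
Qed.

(** Every nonempty fiber is {0} or arises by set differences from levels of f, levels of f within
    [M], [orthc L] and {0}. The sums over these are given by [level_sum_all], [level_sum_sub] and
    [orthcK], hence depend only on the label of a for the exchanged pair. *)
Lemma sum_fiber_label i a b :
  label g L M a = label g L M b ->
  \sum_(x | label f M L x == i) chi (dot a x) =
  \sum_(x | label f M L x == i) chi (dot b x).
Proof.
have [Hf Hg] := fg.
move=> [ab0 abL abM abg].
have sum_set (P : pred V) c :
    \sum_(x in [set x | P x]) chi (dot c x) = \sum_(x | P x) chi (dot c x).
  by apply: eq_bigl => x; rewrite inE.
have level_all j : \sum_(x in [set x | f x == j]) chi (dot a x) =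
    \sum_(x in [set x | f x == j]) chi (dot b x).
  by apply: (mulfI p_neq0); rewrite !sum_set !level_sum_all ab0 abL abg.
have level_sub j : \sum_(x in [set x in M | f x == j]) chi (dot a x) =
    \sum_(x in [set x in M | f x == j]) chi (dot b x).
  by apply: (mulfI p_neq0); rewrite !sum_set !level_sum_sub abM abL abg.
have level_orth : \sum_(x in orthc L) chi (dot a x) =
    \sum_(x in orthc L) chi (dot b x).
  rewrite !sum_subspace ?(orthcK p_prime z_prim (dual_space Hf)) ?abL //;
    exact: subspace_orthc.
have sum_diff (A B : {set V}) c : B \subset A ->
    \sum_(x in A :\: B) chi (dot c x) =
    \sum_(x in A) chi (dot c x) - \sum_(x in B) chi (dot c x).
  move=> /setIidPr BA; rewrite [X in _ = X - _](big_setID B) /= BA.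
  by rewrite addrAC subrr add0r.
have sum_fiber c : \sum_(x | label f M L x == i) chi (dot c x) =
    \sum_(x in fiber i) chi (dot c x).
  by apply: eq_bigl => x; rewrite inE.
(* Labels outside [labels3] have empty fibers. *)
rewrite !sum_fiber; have [i3|i3] := boolP (i \in labels3); last first.
  rewrite !big_pred0 // => x; rewrite inE; apply/eqP => xi.
  - by move: i3; rewrite -xi label_in.
  - by move: i3; rewrite -xi label_in.
move: i3; rewrite inE mem_cat 2!in_cons.
move=> /or4P [/eqP->|/mapP [j _ ->]|/eqP->|].
- by rewrite fiber_zero !big_set1 !dot0r.
- have -> : fiber (false, false, false, j) =
      [set x | f x == j] :\: [set x in M | f x == j].
    rewrite fiber_out; apply/setP => x; rewrite !inE.
    by case: (f x == j); rewrite ?andbF ?andbT.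
  by rewrite !sum_diff ?level_all ?level_sub //; apply/subsetP => x;
    rewrite !inE => /andP [].
- rewrite fiber_orthc !sum_diff ?level_orth ?big_set1 ?dot0r //;
    by rewrite sub1set orthc0.
case/orP => [/eqP->|/mapP [j]].
  rewrite fiber_sub0 !sum_diff ?level_orth ?level_sub //;
    by apply/subsetP => x xL; rewrite inE; apply: orthc_sub_dual.
by rewrite mem_filter => /andP [j0 _] ->; rewrite fiber_sub // level_sub.
Qed.
End LevelSums.
End DualPair.

(** * Block sizes and the two schemes *)

Section DualPairScheme.
Variables (C : numClosedFieldType) (p : nat) (z : C) (n m r : nat).
Hypotheses (p_prime : prime p) (z_prim : p.-primitive_root z).
Hypothesis (n_eq : n = (2 * m)%N).
Local Notation chi := (@addchar C p z).
Local Notation wsum := (@walsh_sum C p z n).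
Local Notation V := 'rV['F_p]_n.
Local Notation dual_pair := (@dual_pair C p z n m r).
Section LevelSums.
Variables (f g : V -> 'F_p) (L M : {set V}) (l h : nat).
Hypothesis fg : dual_pair f g L M l h.
Lemma sum_dot0 (A : pred V) :
  \sum_(x | A x) chi (dot 0 x) = #|[set x | A x]|%:R.
Proof.
rewrite -sum1_card natr_sum; apply: eq_big => [x|x _]; first by rewrite inE.
by rewrite dot0l chi0.
Qed.

Lemma twist0r (j : 'F_p) : @twist C p z l j 0 = p%:R *+ (j == 0) - 1.
Proof.
rewrite /twist (eq_bigr (fun t => chi (t * (- j)))).
  have := sum_chi p_prime z_prim (- j); rewrite (bigD1 0) //= mul0r oppr_eq0.
  by move=> <-; rewrite chi0 addrAC subrr add0r.
by move=> t _; rewrite mulr0 mulr0 add0r mulrN.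
Qed.

(** The level sum at a = 0, with terms moved so that no truncated subtraction occurs. *)
Lemma card_level_sub j :
  (p * #|[set x in M | f x == j]| + p ^ m.+1 * (j == 0%R) = p ^ r + p ^ m)%N.
Proof.
have [Hf Hg] := fg; apply/eqP; rewrite -(eqr_nat C); apply/eqP.
have := level_sum_sub p_prime z_prim n_eq fg j 0.
rewrite orthc0 (dual0 Hf) twist0r; have [-> _ _] := dual_space Hf.
rewrite sum_dot0 natrD !natrM => ->; rewrite natrD !natrX exprS.
by case: (j == 0) => /=; ring.
Qed.

(** At a = 0 both level sums carry the same [twist] term, since 0 lies in [L]; it cancels, so f
    takes all values equally often outside [M]. *)
Lemma card_level_out j :
  (p * #|[set x | f x == j] :\: M| + p ^ r = p ^ n)%N.
Proof.
have [Hf Hg] := fg; apply/eqP; rewrite -(eqr_nat C); apply/eqP.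
have := level_sum_all p_prime z_prim fg j 0.
rewrite eqxx (dual0 Hf) twist0r; have [-> _ _] := dual_space Hf.
rewrite sum_dot0 => all_j.
have := card_level_sub j => /(congr1 (fun k => k%:R : C)).
have -> : [set x in M | f x == j] = [set x | f x == j] :&: M.
  by apply/setP => x; rewrite !inE andbC.
rewrite !natrD !natrM => sub_j.
have := cardsID M [set x | f x == j] => /(congr1 (fun k => k%:R : C)).
rewrite natrD => id_j; move: all_j; rewrite -id_j mulrDr => all_j.
apply: (addrI (p%:R * #|[set x | f x == j] :&: M|%:R)).
rewrite addrA all_j.
move: sub_j => /(canRL (addrK _)) ->; rewrite !natrX exprS.
by case: (j == 0) => /=; ring.
Qed.

Lemma card_orthc_dual : (p ^ r * #|orthc L| = p ^ n)%N.
Proof.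
have [Hf _] := fg.
by rewrite -(dual_card Hf); apply: (card_orthc p_prime z_prim (dual_space Hf)).
Qed.

Lemma labelN x : label f M L (- x) = label f M L x.
Proof.
have [Hf Hg] := fg.
rewrite /label oppr_eq0 (subspaceN _ (dual_space Hg)) (dualN Hg).
by rewrite subspaceN //; apply: subspace_orthc.
Qed.

Lemma label0P x : label f M L x = label f M L 0 -> x = 0.
Proof. by case; rewrite eqxx => /eqP. Qed.

Lemma fiber_nonempty i :
  fiber f M L i != set0 -> exists x, label f M L x = i.
Proof. by case/set0Pn => x; rewrite inE => /eqP <-; exists x. Qed.

Definition labels2 : seq (bool * bool * bool * 'F_p) :=
  (true, true, true, 0)
    :: [seq (false, false, false, j) | j <- enum 'F_p]
    ++ (false, true, true, 0)
    :: [seq (false, true, false, j) | j <- enum 'F_p & j != 0].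

(** Applied to the pair and to the exchanged pair, [sum_fiber_label] gives the two duality
    hypotheses of [fiber_convolution]. *)
Lemma labels_scheme (s : seq (bool * bool * bool * 'F_p)) d :
  size s = d.+1 -> uniq s ->
  nth (true, true, true, 0) s 0 = (true, true, true, 0) ->
  (forall x, label f M L x \in s) -> {in s, forall i, fiber f M L i != set0} ->
  is_partition [seq fiber f M L i | i <- s] /\
  induces_symmetric_scheme d [seq fiber f M L i | i <- s].
Proof.
move=> size_s uniq_s s0 fs sf.
refine (@translation_scheme p n _ (label f M L) s d size_s uniq_s fs _ _ _ _ _).
- by move=> i /sf/fiber_nonempty.
- by rewrite (label_zero fg).
- exact: label0P.
- exact: labelN.
move=> u v w w'; apply: (fiber_convolution p_prime z_prim (k' := label g L M)).
- exact: labelN.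
- by move=> i a b; apply: (sum_fiber_label p_prime z_prim n_eq fg).
move=> i a b; apply: (sum_fiber_label p_prime z_prim n_eq (dual_pairC fg)).
Qed.

Lemma mem_labels3 i :
  (i \in labels3 p) = (i == (false, true, false, 0)) || (i \in labels2).
Proof.
rewrite !inE !mem_cat !inE.
case: (i == (true, true, true, 0)); case: (i == (false, true, false, 0));
by case: (i == (false, true, true, 0)); rewrite ?orbT.
Qed.

Lemma mem_map_label (a : bool * bool * bool) (P : pred 'F_p) i :
  (i \in [seq (a, j) | j <- enum 'F_p & P j]) = (i.1 == a) && P i.2.
Proof.
apply/mapP/andP => [[j]|[]].
  by rewrite mem_filter => /andP [Pj _] ->.
case: i => b j /= /eqP -> Pj; exists j => //.
by rewrite mem_filter Pj mem_enum.
Qed.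

Lemma uniq_labels3 : uniq (labels3 p).
Proof.
have inj (a : bool * bool * bool) : injective (fun j : 'F_p => (a, j)).
  by move=> j k [].
rewrite /labels3 -{1}(filter_predT (enum 'F_p)).
have u (P : pred 'F_p) : uniq [seq j <- enum 'F_p | P j].
  by rewrite filter_uniq ?enum_uniq.
rewrite cons_uniq cat_uniq 2!cons_uniq !map_inj_uniq // !u.
rewrite mem_cat !in_cons !mem_map_label /= -enumT enum_uniq !mem_map_label /=.
rewrite !andbT; apply/hasPn => i.
by rewrite !mem_map_label => /andP [/eqP-> _].
Qed.

Lemma uniq_labels2 : uniq labels2.
Proof.
apply: subseq_uniq uniq_labels3.
apply: (@cat_subseq _ (_ :: _) _ (_ :: _) _ (subseq_refl _)).
by apply: (@cat_subseq _ [:: _] _ [:: _] _ (subseq_refl _)); apply: subseq_cons.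
Qed.

Lemma size_labels3 : size (labels3 p) = (2 * p + 2)%N.
Proof.
have size_nz : size [seq j <- enum 'F_p | j != 0] = p.-1.
  rewrite -[LHS]/(size (filter (predC1 (0 : 'F_p)) (enum 'F_p))).
  by rewrite -rem_filter ?enum_uniq // size_rem ?mem_enum // -cardE card_Fp.
rewrite /= size_cat /= !size_map size_nz -enumT -cardE card_Fp //.
by have := prime_gt0 p_prime; lia.
Qed.

Lemma size_labels2 : size labels2 = (2 * p + 1)%N.
Proof.
have := size_labels3; rewrite /= !size_cat /=; lia.
Qed.

Lemma fiber_out_neq0 j : (r < n)%N ->
  fiber f M L (false, false, false, j) != set0.
Proof.
move=> r_n; rewrite (fiber_out p_prime z_prim n_eq fg) -card_gt0.
have := card_level_out j; have := ltn_exp2l r n (prime_gt1 p_prime).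
rewrite r_n; case: #|_| => // pr; rewrite muln0 add0n => pe.
by rewrite pe ltnn in pr.
Qed.

Lemma fiber_orthc_neq0 : (r < n)%N ->
  fiber f M L (false, true, true, 0) != set0.
Proof.
move=> r_n; rewrite (fiber_orthc p_prime z_prim n_eq fg) -card_gt0.
have := cardsD1 0 (orthc L); rewrite orthc0 => cL.
have := card_orthc_dual; rewrite cL; case: #|_ :\ _| => // pe.
by move: r_n; rewrite -(ltn_exp2l r n (prime_gt1 p_prime)) -pe addn0 muln1 ltnn.
Qed.

Lemma fiber_sub_neq0 j : j != 0 -> fiber f M L (false, true, false, j) != set0.
Proof.
move=> j0; rewrite (fiber_sub p_prime z_prim n_eq fg) // -card_gt0.
have := card_level_sub j; rewrite (negPf j0) muln0 addn0.
case: #|_| => // /esym/eqP; rewrite muln0 addn_eq0 expn_eq0.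
by rewrite eqn0Ngt prime_gt0.
Qed.

Lemma orthc_sub_level0 : orthc L \subset [set x in M | f x == 0].
Proof.
apply/subsetP => x xL; rewrite inE.
exact: (orthc_sub_dual p_prime z_prim n_eq fg).
Qed.

(** Here [p * #|orthc L|] is at most p^m and p^(m+1) < p^r, so by [card_level_sub] the set [orthc L]
    is strictly smaller than the zero level in [M], which contains it. *)
Lemma fiber_sub0_neq0 : (m.+1 < r)%N ->
  fiber f M L (false, true, false, 0) != set0.
Proof.
move=> m_r; rewrite fiber_sub0 -card_gt0.
have cL := card_orthc_dual; have c0 := card_level_sub 0.
have : (#|orthc L| < #|[set x in M | f x == 0%R]|)%N.
  rewrite -(ltn_pmul2l (prime_gt0 p_prime)).
  rewrite -(ltn_add2r (p ^ m.+1 * (0 == 0 :> 'F_p))).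
  rewrite c0 eqxx muln1.
  have p_m : (p ^ m.+1 < p ^ r)%N by rewrite ltn_exp2l ?prime_gt1.
  rewrite [X in (_ < X)%N]addnC -addnS leq_add //.
  have p_r : (0 < p ^ r)%N by rewrite expn_gt0 prime_gt0.
  rewrite -(leq_pmul2l p_r) mulnCA cL n_eq mul2n -addnn expnD mulnA -expnS.
  by rewrite leq_mul2r (ltnW p_m) orbT.
rewrite -(cardsID (orthc L) [set x in M | f x == 0%R]).
have /setIidPr -> := orthc_sub_level0.
by rewrite -[X in (X < _)%N -> _]addn0 ltn_add2l.
Qed.

(** One inclusion is [orthc_sub_level0]; for r = m + 1, p times either cardinal is p^m. *)
Lemma level_sub_orthc : r = m.+1 -> [set x in M | f x == 0] = orthc L.
Proof.
move=> r_m; apply/esym/eqP; rewrite eqEcard orthc_sub_level0 /=.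
have := card_level_sub 0; rewrite eqxx muln1 r_m addnC => /addnI.
have := card_orthc_dual; rewrite r_m [X in _ = (p ^ X)%N -> _]n_eq => cL cM.
have p_m : (0 < p ^ m)%N by rewrite expn_gt0 prime_gt0.
rewrite -(leq_pmul2l (prime_gt0 p_prime)) cM -(leq_pmul2l p_m) mulnA -expnSr cL.
by rewrite -expnD addnn mul2n.
Qed.

Lemma fibers_labels2 : [set x in M | f x == 0] = orthc L ->
  [seq fiber f M L i | i <- labels2] =
  [set 0] :: [seq [set x | f x == j] :\: M | j <- enum 'F_p]
    ++ ([set x in M | f x == 0] :\ 0)
    :: [seq [set x in M | f x == j] | j <- enum 'F_p & j != 0].
Proof.
move=> fM; rewrite /labels2 map_cons map_cat map_cons -!map_comp fM.
rewrite (fiber_zero fg) (fiber_orthc p_prime z_prim n_eq fg).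
congr (_ :: _ ++ _ :: _); apply/eq_in_map => j.
  by move=> _; apply: (fiber_out p_prime z_prim n_eq fg).
rewrite mem_filter => /andP [j0 _].
exact: (fiber_sub p_prime z_prim n_eq fg).
Qed.

Lemma fibers_labels3 :
  [seq fiber f M L i | i <- labels3 p] =
  [set 0] :: [seq [set x | f x == j] :\: M | j <- enum 'F_p]
    ++ (orthc L :\ 0)
    :: ([set x in M | f x == 0] :\: orthc L)
    :: [seq [set x in M | f x == j] | j <- enum 'F_p & j != 0].
Proof.
rewrite /labels3 map_cons map_cat 2!map_cons -!map_comp.
rewrite (fiber_zero fg) (fiber_orthc p_prime z_prim n_eq fg) fiber_sub0.
congr (_ :: _ ++ _ :: _ :: _); apply/eq_in_map => j.
  by move=> _; apply: (fiber_out p_prime z_prim n_eq fg).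
rewrite mem_filter => /andP [j0 _].
exact: (fiber_sub p_prime z_prim n_eq fg).
Qed.

Lemma fiber_labels2_neq0 : (r < n)%N ->
  {in labels2, forall i, fiber f M L i != set0}.
Proof.
move=> r_n i; rewrite inE mem_cat inE => /or4P [/eqP->|/mapP [j _ ->]|/eqP->|].
- by rewrite (fiber_zero fg) -card_gt0 cards1.
- exact: fiber_out_neq0.
- exact: fiber_orthc_neq0.
by case/mapP => j; rewrite mem_filter => /andP [j0 _] ->; apply: fiber_sub_neq0.
Qed.

Lemma dual_pair_scheme2 (U := [set 0]
    :: [seq [set x | f x == j] :\: M | j <- enum 'F_p]
    ++ ([set x in M | f x == 0] :\ 0)
    :: [seq [set x in M | f x == j] | j <- enum 'F_p & j != 0]) :
  (2 <= m)%N -> r = m.+1 ->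
  is_partition U /\ induces_symmetric_scheme (2 * p) U.
Proof.
move=> m_ge2 r_m; have fM := level_sub_orthc r_m.
(* From [2 <= m] follows m + 1 < 2 * m, which makes every level of f meet the complement of [M] and
   makes [orthc L] nonzero. *)
have r_n : (r < n)%N by rewrite r_m; lia.
rewrite /U -fibers_labels2 //.
apply: labels_scheme => //.
- by rewrite size_labels2 addn1.
- exact: uniq_labels2.
- move=> x; have := label_in p_prime z_prim n_eq fg x.
  rewrite mem_labels3 => /orP [/eqP lx|//].
  have : x \in fiber f M L (false, true, false, 0) by rewrite inE lx.
  by rewrite fiber_sub0 fM setDv in_set0.
exact: fiber_labels2_neq0.
Qed.

Lemma dual_pair_scheme3 (U := [set 0]
    :: [seq [set x | f x == j] :\: M | j <- enum 'F_p]
    ++ (orthc L :\ 0)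
    :: ([set x in M | f x == 0] :\: orthc L)
    :: [seq [set x in M | f x == j] | j <- enum 'F_p & j != 0]) :
  (m.+1 < r < n)%N -> is_partition U /\ induces_symmetric_scheme (2 * p + 1) U.
Proof.
move=> /andP [m_r r_n]; rewrite /U -fibers_labels3 //.
apply: labels_scheme => //.
- by rewrite size_labels3 addnS.
- exact: uniq_labels3.
  exact: (label_in p_prime z_prim n_eq fg).
move=> i; rewrite mem_labels3 => /orP [/eqP->|]; first exact: fiber_sub0_neq0.
exact: fiber_labels2_neq0.
Qed.
End LevelSums.
End DualPairScheme.

(** * Duals of homogeneous bent functions *)

Section Homogeneous.
Variables (C : numClosedFieldType) (p : nat) (z : C) (n m : nat).
Hypotheses (p_prime : prime p) (p_odd : odd p) (z_prim : p.-primitive_root z).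
Hypothesis (n_eq : n = (2 * m)%N).
Local Notation chi := (@addchar C p z).
Local Notation wsum := (@walsh_sum C p z n).
Local Notation V := 'rV['F_p]_n.

Let P_neq0 : p%:R ^+ m != 0 :> C.
Proof. by rewrite expf_neq0 // pnatr_eq0 -lt0n prime_gt0. Qed.

Let Pint (s : bool) : (-1) ^+ s * p%:R ^+ m = ((-1) ^+ s * p%:Z ^+ m)%:~R :> C.
Proof. by rewrite rmorphM !rmorphXn /= rmorphN1 -pmulrn. Qed.

Let odd_P (s : bool) : odd `|(-1) ^+ s * p%:Z ^+ m|.
Proof.
by rewrite abszM !abszX abszN absz1 exp1n mul1n /= oddX p_odd orbT.
Qed.

Lemma chi_inj : injective chi.
Proof.
move=> a b ab; apply/eqP; rewrite -subr_eq0 -(chi_eq1 p_prime z_prim).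
by rewrite chiD // chiN // ab mulfV ?chi_neq0.
Qed.

(** Raising to the p-th power, p odd, sends chi to 1 and keeps the sign, so the signs agree
    first. *)
Lemma sign_chi_inj (s u : bool) a b :
  (-1) ^+ s * chi a = (-1) ^+ u * chi b -> a = b.
Proof.
have chip c : chi c ^+ p = 1.
  by rewrite /addchar exprAC (prim_expr_order z_prim) expr1n.
have signp (v : bool) : ((-1) ^+ v) ^+ p = (-1) ^+ v :> C.
  by case: v; rewrite ?expr1n // expr1 -signr_odd p_odd expr1.
move=> E; have := congr1 (fun x => x ^+ p) E.
rewrite /= !exprMn !chip !signp !mulr1 => su; move: E; rewrite su.
have u0 : (-1) ^+ u != 0 :> C by rewrite signr_eq0.
by move/(mulfI u0)/chi_inj.
Qed.

Variables (f : V -> 'F_p) (h : nat).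
Hypotheses (f0 : f 0 = 0) (h_gt0 : (0 < h)%N)
  (h_co : gcdn (h - 1) (p - 1) = 1%N)
  (fZ : forall (t : 'F_p) x, t != 0 -> f (t *: x) = t ^+ h * f x).

(** Being coprime to the even number [p - 1], [h - 1] is odd. *)
Lemma degree_even : odd h = false.
Proof.
have p1_even : (2 %| p - 1)%N by rewrite dvdn2 oddB ?prime_gt0 // p_odd.
apply/negP => h_odd; have : (2 %| gcdn (h - 1) (p - 1))%N.
  by rewrite dvdn_gcd p1_even dvdn2 oddB // h_odd.
by rewrite h_co.
Qed.

Lemma homogeneous_even x : f (- x) = f x.
Proof.
rewrite -scaleN1r fZ ?oppr_eq0 ?oner_eq0 // -signr_odd degree_even.
by rewrite expr0 mul1r.
Qed.

(** The witness k is an inverse of h - 1 modulo p - 1, so t^k is an (h - 1)-th root of t. *)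
Lemma root_degree : exists k, forall t : 'F_p, t != 0 -> t ^+ (k * (h - 1)) = t.
Proof.
have h1_gt0 : (0 < h - 1)%N.
  rewrite subn_gt0 ltn_neqAle h_gt0 andbT.
  by apply: contraFneq degree_even => <-.
have [k j kj _] := egcdnP (p - 1) h1_gt0.
exists k => t t0; rewrite kj h_co addn1 exprSr mulnC exprM.
suff -> : t ^+ (p - 1) = 1 by rewrite expr1n mul1r.
apply: (mulIf t0); rewrite mul1r -exprSr subn1 prednK ?prime_gt0 //.
by have := expf_card t; rewrite card_Fp.
Qed.

Section Dual.
Variables (g : V -> 'F_p) (L : {set V}).
Hypothesis fg : forall a, wsum f a = (-1) ^+ (a \in L) * p%:R ^+ m * chi (g a).

(** Substitute t^k x for x, with k from [root_degree]: f is scaled by t^(k h) and x.(t a) involves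
    t^(k + 1), which is the same factor. So W_f at t a is the conjugate of W_f at a under z ->
    z^(t^(k h)). *)
Lemma dual_homogeneous :
  exists k, forall (t : 'F_p) a, t != 0 -> g (t *: a) = t ^+ (k * h) * g a.
Proof.
have [k kP] := root_degree; exists k => t a t0.
have tk0 : t ^+ k != 0 by rewrite expf_neq0.
have tkh : t ^+ (k * h) = t ^+ k * t.
  by rewrite -[X in _ = _ * X](kP t t0) -exprD -mulnS -addn1 subnK.
have th0 : t ^+ (k * h) != 0 by rewrite expf_neq0.
have E : wsum f (t *: a) =
    (-1) ^+ (a \in L) * p%:R ^+ m * chi (t ^+ (k * h) * g a).
  have := fg a; rewrite Pint => /(chi_galois p_prime z_prim th0).
  rewrite -Pint => <-.
  rewrite /walsh_sum (reindex_inj (scalerI tk0)) /=; apply: eq_bigr => x _.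
  by rewrite fZ // dotZr dotZl mulrA -tkh exprM mulrBr.
move: E; rewrite fg -!mulrA ![p%:R ^+ m * _]mulrC !mulrA => /(mulIf P_neq0).
exact: sign_chi_inj.
Qed.

Lemma dual_even a : g (- a) = g a.
Proof.
have [k gZ] := dual_homogeneous.
rewrite -scaleN1r gZ ?oppr_eq0 ?oner_eq0 // -signr_odd oddM degree_even.
by rewrite andbF expr0 mul1r.
Qed.

(* Pairing x with - x makes the sum of chi (f x) over x != 0 divisible by 2. *)
Lemma dual_at0 : g 0 = 0.
Proof.
pose lt_opp (x : V) := (enum_rank x < enum_rank (- x))%N.
have opp_eq (x : V) : (x == - x) = (x == 0).
  apply/eqP/eqP => [/eqP|->]; last by rewrite oppr0.
  rewrite -subr_eq0 opprK -mulr2n -scaler_nat scaler_eq0.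
  move=> /orP [/eqP two0|/eqP//].
  have /eqP : nat_of_ord (2%:R : 'F_p) = 0%N by rewrite two0.
  by rewrite val_Fp_nat // modn_small // odd_prime_gt2.
apply: (chi_parity p_prime z_prim (A := lt_opp) (phi := f) (u := 1)
  p_odd (odd_P (0 \in L))).
rewrite -Pint -fg /walsh_sum.
under [in RHS]eq_bigr do rewrite dot0l subr0.
rewrite [X in _ = X - _](bigD1 (0 : V)) //= f0 chi0 mul1r addrAC subrr add0r.
rewrite [RHS](bigID lt_opp) /=.
have -> : \sum_(x | (x != 0) && lt_opp x) chi (f x) =
    \sum_(x | lt_opp x) chi (f x).
  apply: eq_bigl => x; apply: andb_idl; apply: contraTneq => ->.
  by rewrite /lt_opp oppr0 ltnn.
have -> : \sum_(x | (x != 0) && ~~ lt_opp x) chi (f x) =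
    \sum_(x | lt_opp x) chi (f x).
  rewrite (reindex_inj (@oppr_inj V)); apply: eq_big => [x|x _]; last first.
    by rewrite homogeneous_even.
  rewrite oppr_eq0 /lt_opp opprK -leqNgt leq_eqVlt (inj_eq val_inj).
  rewrite (inj_eq enum_rank_inj) opp_eq; have [->|] := eqVneq x 0.
    by rewrite oppr0 ltnn.
  by [].
by rewrite mulr2n mulrDl mul1r.
Qed.

Variables (f2 : V -> 'F_p) (M : {set V}).
Hypothesis gf : forall x, wsum g x = (-1) ^+ (x \in M) * p%:R ^+ m * chi (f2 x).

(** Twice the sum over [L] of chi (g a - x.a) is, up to the sign of its first term, p^m chi (f2 x)
    minus p^m chi (f x); [chi_parity] then equates the exponents because p is odd. *)
Lemma double_dual x : f2 x = f x.
Proof.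
apply: (chi_parity p_prime z_prim (A := mem L) (phi := fun a => g a - dot x a)
  p_odd (odd_P (x \in M)) (u := (-1) ^+ false * p%:Z ^+ m)).
rewrite -!Pint -gf expr0 mul1r.
have := wsum_sign_inv p_prime z_prim n_eq x fg; rewrite homogeneous_even => <-.
rewrite /walsh_sum -sumrB [RHS](bigID (mem L)) /=.
rewrite [X in _ = _ + X]big1 ?addr0.
  rewrite mulr_sumr; apply: eq_bigr => a ->; rewrite expr1; ring.
by move=> a /negPf->; rewrite expr0 mul1r subrr.
Qed.

Lemma dual_pair_of_bent r : subspace L -> #|L| = (p ^ r)%N ->
  subspace M -> #|M| = (p ^ r)%N -> exists l, dual_pair z m r f g L M l h.
Proof.
move=> sL cL sM cM; have [k gZ] := dual_homogeneous; exists (k * h)%N.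
split; split=> //; first exact: dual_even.
- exact: dual_at0.
- by move=> a; rewrite gf double_dual.
exact: homogeneous_even.
Qed.

End Dual.
End Homogeneous.

(** * Bent functions over the complex numbers *)

Section RealBent.
Variables (R : realType) (p n m : nat).
Hypotheses (p_prime : prime p) (p_odd : odd p) (n_eq : n = (2 * m)%N).
Local Open Scope complex_scope.
Local Notation V := 'rV['F_p]_n.
Local Notation chi := (@addchar R[i] p (xi R p)).
Implicit Types f : V -> 'F_p.

Lemma cos_sin_exp (t : R) k :
  (cos t +i* sin t) ^+ k = cos (t *+ k) +i* sin (t *+ k).
Proof.
elim: k => [|k IHk]; first by rewrite expr0 mulr0n cos0 sin0.
rewrite exprS IHk mulrS cosD sinD; apply/eqP.
by rewrite eq_complex /= eqxx /= addrC.
Qed.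

(** The order divides p, and it is not 1: the angle 2 pi / p is a nonzero point of [0, pi], where
    the cosine is injective. *)
Lemma xi_prim : p.-primitive_root (xi R p).
Proof.
have p_gt0 : 0 < p%:R :> R by rewrite ltr0n prime_gt0.
have xi_p : xi R p ^+ p = 1.
  rewrite /xi cos_sin_exp -[_ *+ p]mulr_natr divfK ?gt_eqF //.
  by rewrite mulr_natl cos2pi sin2pi.
have [d d_prim] := prim_order_exists (prime_gt0 p_prime) xi_p.
case/primeP: p_prime => _ /[apply] /pred2P [d1|dp]; last by rewrite -{1}dp.
have := prim_expr_order d_prim; rewrite d1 expr1 => -[cos1 _].
have t_ge0 : 0 <= 2 * pi / p%:R :> R.
  by rewrite divr_ge0 ?mulr_ge0 ?pi_ge0 ?ler0n.
have t_lepi : 2 * pi / p%:R <= pi :> R.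
  rewrite ler_pdivrMr // mulrC ler_wpM2l ?pi_ge0 //.
  by rewrite ler_nat prime_gt1.
have /eqP : 2 * pi / p%:R = 0 :> R.
  by apply: cos_inj; rewrite ?cos0 // in_itv /= ?t_ge0 ?t_lepi ?lexx ?pi_ge0.
by rewrite gt_eqF // divr_gt0 ?mulr_gt0 ?pi_gt0 ?ltr0n ?prime_gt0.
Qed.

(** An odd square is 1 modulo 4, and n is even. *)
Lemma mu1 : mu R p n = 1.
Proof.
rewrite /mu n_eq expnM -modnXm.
suff -> : (p ^ 2 %% 4 = 1)%N by rewrite exp1n eqxx.
rewrite -modnXm; have : odd (p %% 4) by rewrite odd_mod.
have : (p %% 4 < 4)%N by rewrite ltn_mod.
by case: (p %% 4)%N => [|[|[|[|]]]].
Qed.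

Lemma root_pnE : root_pn R p n = p%:R ^+ m.
Proof.
rewrite /root_pn n_eq mulnC exprM sqrtr_sqr ger0_norm ?exprn_ge0 ?ler0n //.
by rewrite rmorphXn rmorph_nat.
Qed.

(** Walsh values lie in Z[z] and have squared modulus p^(2m), so [cint_sqrt_norm] applies. *)
Lemma bent_value f a : bent R f ->
  exists (s : bool) (j : 'F_p), walsh R f a = (-1) ^+ s * p%:R ^+ m * chi j.
Proof.
move=> fb; apply: (cint_sqrt_norm p_prime xi_prim).
  by apply: cint_sum => x _; apply/cintX/cint_root.
by rewrite -normCK fb root_pnE -exprM mulnC.
Qed.

Lemma walsh_dual f a : bent R f ->
  walsh R f a = (-1) ^+ (a \in Bminus R f) * p%:R ^+ m * chi (dual R f a).
Proof.
move=> fb; have [s [j Ej]] := bent_value a fb.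
(* The [pick] inside [dual] succeeds, with the [j] from [bent_value] as a witness. *)
have dualP : (walsh R f a == p%:R ^+ m * chi (dual R f a)) ||
    (walsh R f a == - (p%:R ^+ m * chi (dual R f a))).
  rewrite /dual mu1 root_pnE mul1r; case: pickP => [//|/(_ j)].
  rewrite Ej; case: s {Ej}; rewrite /= ?expr0 ?mul1r ?eqxx //.
  by rewrite expr1 mulN1r mulNr eqxx orbT.
rewrite inE mu1 root_pnE mul1r; case: eqP => [->|/eqP neq].
  by rewrite expr1 mulN1r mulNr.
by move: dualP; rewrite (negPf neq) orbF => /eqP; rewrite expr0 mul1r.
Qed.

Lemma Bplus_setC f : bent R f -> Bplus R f = ~: Bminus R f.
Proof.
move=> fb; apply/setP => a.
rewrite in_setC inE (walsh_dual a fb) mu1 root_pnE mul1r.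
have P0 : p%:R ^+ m * chi (dual R f a) != 0.
  rewrite mulf_neq0 ?(chi_neq0 p_prime xi_prim) // expf_neq0 //.
  by rewrite pnatr_eq0 -lt0n prime_gt0.
case: (a \in _) => /=; last by rewrite expr0 mul1r eqxx.
rewrite expr1 mulN1r mulNr -subr_eq0 -opprD oppr_eq0 -mulr2n mulrn_eq0.
exact: negPf P0.
Qed.

End RealBent.

(** * Reduction of the theorem to dual pairs *)

Lemma nondegenerate_subspaceP p n r (A : {set 'rV['F_p]_n}) : prime p ->
  nondegenerate_subspace r A -> subspace A /\ #|A| = (p ^ r)%N.
Proof.
move=> p_prime [U [-> dimU _]]; split.
  by split=> [|x y|t x]; rewrite !inE; [exact: mem0v|exact: memvD|exact: memvZ].
have := card_vspace U; rewrite dimU card_Fp // => <-.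
by apply: eq_card => x; rewrite inE.
Qed.

Theorem theorem2 (R : realType) (p n r : nat) (f : 'rV['F_p]_n -> 'F_p)
    (p_prime : prime p) (p_odd : odd p)
    (n_ge4 : (4 <= n)%N) (n_even : ~~ odd n)
    (f_nwr : non_weakly_regular R f) (f_DBF : DBF R f)
    (Bf : nondegenerate_subspace r (Bminus R f))
    (Bfs : nondegenerate_subspace r (Bminus R (dual R f))) :
  (r = (n %/ 2 + 1)%N ->
     is_partition (U2 R f) /\
     induces_symmetric_scheme (2 * p) (U2 R f)) /\
  ((n %/ 2 + 1 < r <= n - 1)%N ->
     is_partition (U3 R f) /\
     induces_symmetric_scheme (2 * p + 1) (U3 R f)).
Proof.
pose m := (n %/ 2)%N.
have n_eq : n = (2 * m)%N by rewrite mulnC /m divnK // dvdn2.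
have [[fb gb] f0 [h [h_gt0 h_co fZ]]] := f_DBF.
have [sL cL] := nondegenerate_subspaceP p_prime Bf.
have [sM cM] := nondegenerate_subspaceP p_prime Bfs.
have xiP := xi_prim R p_prime.
have [l fg] := dual_pair_of_bent p_prime p_odd xiP n_eq f0 h_gt0 h_co fZ
  (fun a => walsh_dual p_prime p_odd n_eq a fb)
  (fun a => walsh_dual p_prime p_odd n_eq a gb) sL cL sM cM.
have csetE j : cset R f j = [set x | f x == j] :\: Bminus R (dual R f).
  apply/setP => x.
  rewrite in_setD inE (Bplus_setC p_prime p_odd n_eq gb) in_setC.
  by congr (_ && _); rewrite inE.
have m_ge2 : (2 <= m)%N by lia.
split=> [r_eq|/andP [m_r r_n]].
  have := dual_pair_scheme2 p_prime xiP n_eq fg.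
  (* Only the [cset] blocks are rewritten; [dset] already unfolds to a level of f inside
     [Bminus R (dual R f)]. *)
  rewrite -(eq_map csetE); apply => //.
  by rewrite r_eq addn1.
have := dual_pair_scheme3 p_prime xiP n_eq fg.
rewrite -(eq_map csetE); apply.
by rewrite -addn1 m_r /=; lia.
Qed.
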